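(* Fix $\epsilon\in[0,\epsilon_\circ]$. Let $U$ be an upper semicontinuous viscosity subsolution and $V$ a lower semicontinuous viscosity supersolution of $F^\epsilon_\kappa[\varphi]=0$ on $[0,T)\times\mathbb{R}$. Assume that $U$ and $V$ have linear growth and that $U\le V$ on $\{T\}\times\mathbb{R}$. Then $U\le V$ on $[0,T]\times\mathbb{R}$.
   Context: Let $T>0$. Standing assumptions: $f\in C^2_b(\mathbb{R})$ with $\inf f>0$; $\sigma:\mathbb{R}\to\mathbb{R}$ bounded and Lipschitz with $\inf\sigma>0$; $\bar\gamma:\mathbb{R}\to\mathbb{R}$ bounded continuous with $\iota\le\bar\gamma\le1/f-\iota$ for some $\iota>0$. Let $K>0$, $x_K\ge K$, and let $\hat g_K:\mathbb{R}\to\mathbb{R}$ be uniformly continuous and affine on $[x_K,\infty)$ and on $(-\infty,-x_K]$. $\epsilon_\circ\in(0,1)$ and $\kappa:\mathbb{R}\to\mathbb{R}$ satisfy: $\kappa\in C^\infty$ with bounded derivatives of all orders, $\inf\kappa>0$, $\kappa=|\hat g_K|+1$ on $(-\infty,-x_K]\cup[x_K,\infty)$, and $-1/\epsilon_\circ<\partial_x\kappa<1/\epsilon_\circ$. For $\epsilon\ge0$: $D^\epsilon_\kappa(x):=\{x'\in\mathbb{R}:(x-x')/\kappa(x')\in[-\epsilon,\epsilon]\}$, and $F^\epsilon_\kappa(t,x,q,M):=\min_{x'\in D^\epsilon_\kappa(x)}\min\Big\{-q-\frac{\sigma^2(x')M}{2(1-f(x')M)},\ \bar\gamma(x')-M\Big\}$,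 with $F^\epsilon_\kappa[\varphi](t,x):=F^\epsilon_\kappa(t,x,\partial_t\varphi(t,x),\partial^2_{xx}\varphi(t,x))$. (For $\epsilon=0$, $D^0_\kappa(x)=\{x\}$ and $F^0_\kappa[\varphi]=\min\{-\partial_t\varphi-\frac{\sigma^2\partial^2_{xx}\varphi}{2(1-f\partial^2_{xx}\varphi)},\bar\gamma-\partial^2_{xx}\varphi\}$.) *)

(* Defs.v *)
From Stdlib Require Import Reals Lra.
From Coquelicot Require Import Coquelicot.
Open Scope R_scope.

Definition bounded_fun (g : R -> R) : Prop :=
  exists C : R, forall x : R, Rabs (g x) <= C.

Definition lipschitz_fun (g : R -> R) : Prop :=
  exists L : R, forall x y : R, Rabs (g x - g y) <= L * Rabs (x - y).

Definition unif_continuous (g : R -> R) : Prop :=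
  forall e : R, 0 < e -> exists d : R, 0 < d /\
    forall x y : R, Rabs (x - y) < d -> Rabs (g x - g y) < e.

(* f in C^2_b(R): twice differentiable, f, f', f'' continuous and bounded
   (continuity of f, f' follows from differentiability). *)
Definition C2b (g : R -> R) : Prop :=
  (forall x, ex_derive g x) /\
  (forall x, ex_derive (Derive g) x) /\
  (forall x, continuous (Derive (Derive g)) x) /\
  bounded_fun g /\ bounded_fun (Derive g) /\ bounded_fun (Derive (Derive g)).

Definition Cinf_bdd_derivs (g : R -> R) : Prop :=
  (forall (n : nat) (x : R), ex_derive (Derive_n g n) x) /\
  (forall n : nat, (1 <= n)%nat -> bounded_fun (Derive_n g n)).

Definition affine_right_of (g : R -> R) (a : R) : Prop :=
  exists c d : R, forall x : R, a <= x -> g x = c * x + d.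
Definition affine_left_of (g : R -> R) (a : R) : Prop :=
  exists c d : R, forall x : R, x <= - a -> g x = c * x + d.

Definition inD (eps : R) (kappa : R -> R) (x x' : R) : Prop :=
  - eps <= (x - x') / kappa x' /\ (x - x') / kappa x' <= eps.

Definition Finner (sigma f gbar : R -> R) (q M x' : R) : R :=
  Rmin (- q - (sigma x' ^ 2 * M) / (2 * (1 - f x' * M))) (gbar x' - M).

(* F^eps_kappa(t,x,q,M) <= 0, i.e. min over D^eps_kappa(x) of Finner <= 0 *)
Definition F_le0 (eps : R) (kappa sigma f gbar : R -> R) (x q M : R) : Prop :=
  exists x' : R, inD eps kappa x x' /\ Finner sigma f gbar q M x' <= 0.

(* F^eps_kappa(t,x,q,M) >= 0, i.e. min over D^eps_kappa(x) of Finner >= 0 *)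
Definition F_ge0 (eps : R) (kappa sigma f gbar : R -> R) (x q M : R) : Prop :=
  forall x' : R, inD eps kappa x x' -> 0 <= Finner sigma f gbar q M x'.

Definition dt (phi : R -> R -> R) (t x : R) : R := Derive (fun s => phi s x) t.
Definition dxx (phi : R -> R -> R) (t x : R) : R :=
  Derive (fun y => Derive (fun z => phi t z) y) x.

Definition C12 (phi : R -> R -> R) : Prop :=
  (forall t x, ex_derive (fun s => phi s x) t) /\
  (forall t x, ex_derive (fun y => phi t y) x) /\
  (forall t x, ex_derive (fun y => Derive (fun z => phi t z) y) x) /\
  (forall p : R * R,
     continuous (fun q : R * R => phi (fst q) (snd q)) p /\
     continuous (fun q : R * R => dt phi (fst q) (snd q)) p /\
     continuous (fun q : R * R => Derive (fun z => phi (fst q) z) (snd q)) p /\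
     continuous (fun q : R * R => dxx phi (fst q) (snd q)) p).

Definition usc_on (T : R) (U : R -> R -> R) : Prop :=
  forall t x, 0 <= t <= T -> forall e, 0 < e -> exists d, 0 < d /\
    forall s y, 0 <= s <= T -> Rabs (s - t) < d -> Rabs (y - x) < d ->
      U s y < U t x + e.

Definition lsc_on (T : R) (V : R -> R -> R) : Prop :=
  forall t x, 0 <= t <= T -> forall e, 0 < e -> exists d, 0 < d /\
    forall s y, 0 <= s <= T -> Rabs (s - t) < d -> Rabs (y - x) < d ->
      V t x - e < V s y.

Definition linear_growth (T : R) (U : R -> R -> R) : Prop :=
  exists C, forall t x, 0 <= t <= T -> Rabs (U t x) <= C * (1 + Rabs x).

Definition loc_max_at (T : R) (W : R -> R -> R) (t0 x0 : R) : Prop :=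
  exists d, 0 < d /\ forall s y, 0 <= s < T -> Rabs (s - t0) < d ->
    Rabs (y - x0) < d -> W s y <= W t0 x0.

Definition loc_min_at (T : R) (W : R -> R -> R) (t0 x0 : R) : Prop :=
  exists d, 0 < d /\ forall s y, 0 <= s < T -> Rabs (s - t0) < d ->
    Rabs (y - x0) < d -> W t0 x0 <= W s y.

Definition visc_subsol (T eps : R) (kappa sigma f gbar : R -> R) (U : R -> R -> R) : Prop :=
  usc_on T U /\
  forall (phi : R -> R -> R) (t0 x0 : R), C12 phi -> 0 <= t0 < T ->
    loc_max_at T (fun s y => U s y - phi s y) t0 x0 ->
    F_le0 eps kappa sigma f gbar x0 (dt phi t0 x0) (dxx phi t0 x0).

Definition visc_supersol (T eps : R) (kappa sigma f gbar : R -> R) (V : R -> R -> R) : Prop :=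
  lsc_on T V /\
  forall (phi : R -> R -> R) (t0 x0 : R), C12 phi -> 0 <= t0 < T ->
    loc_min_at T (fun s y => V s y - phi s y) t0 x0 ->
    F_ge0 eps kappa sigma f gbar x0 (dt phi t0 x0) (dxx phi t0 x0).

(* Main.v *)
(* On the region [M <= gbar], where [1 - f M] is bounded away from 0, the operator is
   concave in [(q, M)].  Hence replacing [V] by a convex combination with the strict
   classical supersolution [a (T - t) + (iota/4) x^2 + b] makes it strict, and the
   quadratic term confines the comparison to a compact set.

   Since there, besides, the operator is uniformly continuous in the space variable and
   does not depend on the gradient, the doubling-of-variables argument needs only jets
   with [M1 <= M2 + d] and nearly equal time derivatives, not the matrix inequality of
   the Crandall-Ishii lemma.  In one space dimension such jets are obtained
   without Alexandrov's theorem, by touching sup-convolutions with chord parabolas. *)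

Require Import Defs.
From Stdlib Require Import Reals Lra Lia Classical ClassicalEpsilon.
From Coquelicot Require Import Coquelicot.
Open Scope R_scope.

(** The minimum over [D] makes the equation nonlocal: jets at two points [x1], [y1] involve two
    different sets. The subsolution inequality holds only at some unknown [z] of the first set, the
    supersolution inequality on all of the second, so it suffices to find a point of the second set
    near [z]. This is where the strict bound on the derivative of [kappa] enters.

    A further obstacle is the term [gbar - M]: a jet of [U] with [M >= gbar] satisfies the
    subsolution inequality trivially. The quadratic part of the strict supersolution excludes this
    case, since it keeps the averaged curvature below [gbar] by a margin proportional to its weight.

    The admissible errors are fixed in terms of that weight before the doubling parameter, so one
    finite parameter suffices and no limit of maximisers is taken. Jets are relative to [[0,T)], so
    a maximum at time 0 needs no separate treatment. *)

(** * Compactness and maxima of semicontinuous sums *)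

Lemma bounded_seq_cluster (u : nat -> R) (a b : R) :
  (forall k, a <= u k <= b) ->
  exists (phi : nat -> nat) (l : R),
    filterlim phi eventually eventually /\ a <= l <= b /\
    is_lim_seq (fun k => u (phi k)) l.
Proof.
intros Hu.
destruct (Bolzano_Weierstrass u _ (compact_P3 a b) Hu) as [l Hl].
assert (H : forall k : nat, exists j : nat, (k <= j)%nat /\ Rabs (u j - l) < / INR (S k)).
{ intros k.
  assert (Hk : 0 < / INR (S k)) by (apply Rinv_0_lt_compat, lt_0_INR; lia).
  destruct (Hl (disc l (mkposreal _ Hk)) k) as [j [Hj1 Hj2]].
  - exists (mkposreal _ Hk); intros x Hx; exact Hx.
  - exists j; split; [exact Hj1 | exact Hj2]. }
destruct (constructive_indefinite_description _ (choice _ H)) as [phi Hphi].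
assert (Hlim : is_lim_seq (fun k => u (phi k)) l).
{ apply is_lim_seq_spec; intros e.
  destruct (archimed_cor1 e (cond_pos e)) as [N [HN1 HN2]].
  exists N; intros k Hk.
  apply Rlt_trans with (1 := proj2 (Hphi k)).
  apply Rle_lt_trans with (2 := HN1).
  apply Rinv_le_contravar; [apply lt_0_INR; lia | apply le_INR; lia]. }
exists phi, l; split; [|split; [split|exact Hlim]].
- intros P [N HN]; exists N; intros k Hk; apply HN.
  apply Nat.le_trans with (1 := Hk), Hphi.
- apply (is_lim_seq_le (fun _ => a) (fun k => u (phi k)) a l); auto using is_lim_seq_const.
  intros k; apply Hu.
- apply (is_lim_seq_le (fun k => u (phi k)) (fun _ => b) l b); auto using is_lim_seq_const.
  intros k; apply Hu.
Qed.

Lemma bounded_seq4_cluster (u v w z : nat -> R) (a1 b1 a2 b2 a3 b3 a4 b4 : R) :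
  (forall k, a1 <= u k <= b1) -> (forall k, a2 <= v k <= b2) ->
  (forall k, a3 <= w k <= b3) -> (forall k, a4 <= z k <= b4) ->
  exists (phi : nat -> nat) (lu lv lw lz : R),
    filterlim phi eventually eventually /\
    (a1 <= lu <= b1 /\ is_lim_seq (fun k => u (phi k)) lu) /\
    (a2 <= lv <= b2 /\ is_lim_seq (fun k => v (phi k)) lv) /\
    (a3 <= lw <= b3 /\ is_lim_seq (fun k => w (phi k)) lw) /\
    (a4 <= lz <= b4 /\ is_lim_seq (fun k => z (phi k)) lz).
Proof.
intros Hu Hv Hw Hz.
destruct (bounded_seq_cluster u a1 b1 Hu) as [f1 [lu [F1 [Bu Lu]]]].
destruct (bounded_seq_cluster (fun k => v (f1 k)) a2 b2) as [f2 [lv [F2 [Bv Lv]]]]; [intros k; apply Hv|].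
destruct (bounded_seq_cluster (fun k => w (f1 (f2 k))) a3 b3) as [f3 [lw [F3 [Bw Lw]]]]; [intros k; apply Hw|].
destruct (bounded_seq_cluster (fun k => z (f1 (f2 (f3 k)))) a4 b4) as [f4 [lz [F4 [Bz Lz]]]]; [intros k; apply Hz|].
exists (fun k => f1 (f2 (f3 (f4 k)))), lu, lv, lw, lz.
assert (F34 := filterlim_comp _ _ _ _ _ _ _ _ F4 F3).
assert (F234 := filterlim_comp _ _ _ _ _ _ _ _ F34 F2).
assert (F1234 := filterlim_comp _ _ _ _ _ _ _ _ F234 F1).
repeat split; try tauto.
- exact (is_lim_seq_subseq _ _ _ F234 Lu).
- exact (is_lim_seq_subseq _ _ _ F34 Lv).
- exact (is_lim_seq_subseq _ _ _ F4 Lw).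
Qed.

(** The cluster hypothesis combines compactness of [D] with upper semicontinuity of [F]. It is used
    twice: along a sequence on which [F] would tend to infinity, for boundedness, and along a
    maximising sequence, for attainment. *)
Lemma max_of_cluster (X : Type) (D : X -> Prop) (F : X -> R) (p0 : X) :
  D p0 ->
  (forall p : nat -> X, (forall k, D (p k)) ->
     exists l, D l /\ forall e N, 0 < e -> exists k, (N <= k)%nat /\ F (p k) < F l + e) ->
  exists p, D p /\ forall p', D p' -> F p' <= F p.
Proof.
intros D0 H.
assert (Hb : bound (fun r => exists p, D p /\ r = F p)).
{ apply NNPP; intros Hn.
  assert (Hk : forall k : nat, exists p, D p /\ INR k < F p).
  { intros k; apply NNPP; intros Hk; apply Hn; exists (INR k).
    intros r [p [Dp ->]]; apply Rnot_lt_le; intros Hlt; apply Hk; exists p; tauto. }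
  destruct (constructive_indefinite_description _ (choice _ Hk)) as [p Hp].
  destruct (H p (fun k => proj1 (Hp k))) as [l [Dl Hl]].
  destruct (INR_unbounded (F l + 1)) as [N HN].
  destruct (Hl 1 N Rlt_0_1) as [k [Hk1 Hk2]].
  apply le_INR in Hk1; generalize (proj2 (Hp k)); lra. }
destruct (completeness _ Hb) as [S [HS1 HS2]].
{ exists (F p0), p0; tauto. }
assert (Hk : forall k : nat, exists p, D p /\ S - / INR (k + 1) < F p).
{ intros k; apply NNPP; intros Hk.
  assert (Hpos : 0 < / INR (k + 1)) by (apply Rinv_0_lt_compat, lt_0_INR; lia).
  assert (S <= S - / INR (k + 1)); [|lra].
  apply HS2; intros r [p [Dp ->]]; apply Rnot_lt_le; intros Hlt; apply Hk; exists p; tauto. }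
destruct (constructive_indefinite_description _ (choice _ Hk)) as [p Hp].
destruct (H p (fun k => proj1 (Hp k))) as [l [Dl Hl]].
exists l; split; [exact Dl|]; intros p' Dp'.
apply Rle_trans with S; [apply HS1; exists p'; tauto|].
apply Rnot_lt_le; intros Hlt.
destruct (archimed_cor1 ((S - F l) / 2)) as [N [HN1 HN2]]; [lra|].
destruct (Hl ((S - F l) / 2) N) as [k [Hk1 Hk2]]; [lra|].
assert (/ INR (k + 1) <= / INR N).
{ apply Rinv_le_contravar; [apply lt_0_INR; lia | apply le_INR; lia]. }
generalize (proj2 (Hp k)); lra.
Qed.

Lemma usc_seq (T : R) (A : R -> R -> R) (t x : nat -> R) (lt lx e : R) :
  usc_on T A -> (forall k, 0 <= t k <= T) -> 0 <= lt <= T ->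
  is_lim_seq t lt -> is_lim_seq x lx -> 0 < e ->
  eventually (fun k => A (t k) (x k) < A lt lx + e).
Proof.
intros HA Ht Hlt Lt Lx He.
destruct (HA lt lx Hlt e He) as [d [Hd H]].
apply is_lim_seq_spec in Lt; apply is_lim_seq_spec in Lx.
generalize (filter_and _ _ (Lt (mkposreal d Hd)) (Lx (mkposreal d Hd))).
apply filter_imp; intros k [H1 H2]; apply H; auto.
Qed.

(** One statement serves the doubled functional, the sup-convolutions and the touching by a
    parabola. Continuity is asked of the coupling [Q] alone, in sequential form so that limit rules
    settle it for polynomials. *)
Lemma usc_sum_max (T R1 R2 : R) (A B : R -> R -> R) (Q : R -> R -> R -> R -> R) :
  0 <= T -> 0 <= R1 -> 0 <= R2 -> usc_on T A -> usc_on T B ->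
  (forall (t x s y : nat -> R) (lt lx ls ly : R),
     is_lim_seq t lt -> is_lim_seq x lx -> is_lim_seq s ls -> is_lim_seq y ly ->
     is_lim_seq (fun k => Q (t k) (x k) (s k) (y k)) (Q lt lx ls ly)) ->
  exists t x s y,
    (0 <= t <= T /\ - R1 <= x <= R1 /\ 0 <= s <= T /\ - R2 <= y <= R2) /\
    forall t' x' s' y', 0 <= t' <= T -> - R1 <= x' <= R1 ->
      0 <= s' <= T -> - R2 <= y' <= R2 ->
      A t' x' + B s' y' + Q t' x' s' y' <= A t x + B s y + Q t x s y.
Proof.
intros HT HR1 HR2 HA HB HQ.
destruct (max_of_cluster ((R * R) * (R * R))
  (fun p => (0 <= fst (fst p) <= T /\ - R1 <= snd (fst p) <= R1) /\
            (0 <= fst (snd p) <= T /\ - R2 <= snd (snd p) <= R2))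
  (fun p => A (fst (fst p)) (snd (fst p)) + B (fst (snd p)) (snd (snd p))
     + Q (fst (fst p)) (snd (fst p)) (fst (snd p)) (snd (snd p)))
  ((0, 0), (0, 0))) as [[[t x] [s y]] [Hp Hmax]].
- simpl; lra.
- intros p Hp.
  destruct (bounded_seq4_cluster (fun k => fst (fst (p k))) (fun k => snd (fst (p k)))
    (fun k => fst (snd (p k))) (fun k => snd (snd (p k))) 0 T (-R1) R1 0 T (-R2) R2)
    as [phi [lt [lx [ls [ly [Hphi [[Bt Lt] [[Bx Lx] [[Bs Ls] [By Ly]]]]]]]]]];
    try (intros k; apply Hp).
  exists ((lt, lx), (ls, ly)); split; [simpl; tauto|].
  intros e N He; simpl.
  assert (He3 : 0 < e / 3) by lra.
  assert (LQ := HQ _ _ _ _ _ _ _ _ Lt Lx Ls Ly).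
  apply is_lim_seq_spec in LQ.
  assert (EA := usc_seq T A _ _ lt lx _ HA (fun k => proj1 (proj1 (Hp (phi k)))) Bt Lt Lx He3).
  assert (EB := usc_seq T B _ _ ls ly _ HB (fun k => proj1 (proj2 (Hp (phi k)))) Bs Ls Ly He3).
  assert (EN : eventually (fun k => (N <= phi k)%nat)) by (apply Hphi; exists N; auto).
  destruct (filter_and _ _ EN (filter_and _ _ (LQ (mkposreal _ He3)) (filter_and _ _ EA EB)))
    as [k0 Hk0].
  destruct (Hk0 k0 (Nat.le_refl _)) as [H1 [H2 [H3 H4]]].
  exists (phi k0); split; [exact H1|].
  simpl in H2; apply Rabs_lt_between in H2; simpl in *; lra.
- exists t, x, s, y; simpl in *; split; [tauto|].
  intros t' x' s' y' H1 H2 H3 H4.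
  apply (Hmax ((t', x'), (s', y'))); simpl; tauto.
Qed.

(** * Quadratic jets and the theorem on sums *)

(** The test functions are quadratic polynomials without mixed term. The slope [c] stays existential
    because the operator ignores the gradient; the square in time is there to absorb the time
    penalty of the sup-convolution. *)
Definition quad_jet (T : R) (A : R -> R -> R) (t x q M : R) : Prop :=
  exists a b c : R, q = a + 2 * b * t /\
    loc_max_at T (fun s y => A s y - (a * s + b * s ^ 2 + c * y + M / 2 * y ^ 2)) t x.

Ltac lim_poly :=
  unfold pow;
  repeat match goal with
  | |- is_lim_seq (fun _ => ?c) _ => apply is_lim_seq_const
  | |- is_lim_seq (fun k => @?a k - @?b k) (Finite (?x - ?y)) => apply (is_lim_seq_minus' a b x y)
  | |- is_lim_seq (fun k => @?a k + @?b k) (Finite (?x + ?y)) => apply (is_lim_seq_plus' a b x y)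
  | |- is_lim_seq (fun k => @?a k * @?b k) (Finite (?x * ?y)) => apply (is_lim_seq_mult' a b x y)
  | _ => assumption
  end.

(** In the shift [z], the sup-convolution of the tilted [A] is at most [aP] and [aM] at [h] and
    [- h]. The parabola [P] of curvature [m] through these two values lies strictly below it at 0,
    so their difference has an interior maximum in [z]. Moving [z] together with [x] then transfers
    [P] to [A] as a test function. *)
Lemma quad_jet_of_sup_conv (T r t0 x0 q p K h m aP aM : R) (A : R -> R -> R) :
  0 <= T -> usc_on T A -> 0 <= t0 <= T -> - r <= x0 <= r -> 0 <= K -> 0 < h ->
  (forall t x, 0 <= t <= T -> - r <= x <= r ->
     A t x - q * t - p * x <=
     A t0 x0 - q * t0 - p * x0 + K / 2 * ((t - t0) ^ 2 + (x - x0) ^ 2)) ->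
  (forall t x, 0 <= t <= T -> - r <= x <= r ->
     A t x - q * t - p * x - (K + 1) * ((t - t0) ^ 2 + (x - x0 - h) ^ 2) <= aP) ->
  (forall t x, 0 <= t <= T -> - r <= x <= r ->
     A t x - q * t - p * x - (K + 1) * ((t - t0) ^ 2 + (x - x0 + h) ^ 2) <= aM) ->
  aP + aM - 2 * (A t0 x0 - q * t0 - p * x0) < m * h ^ 2 ->
  - r + (2 * K + 2) * h < x0 < r - (2 * K + 2) * h ->
  exists t1 x1, 0 <= t1 <= T /\
    Rabs (t1 - t0) <= (2 * K + 2) * h /\ Rabs (x1 - x0) <= (2 * K + 2) * h /\
    quad_jet T A t1 x1 (q + 2 * (K + 1) * (t1 - t0)) m.
Proof.
intros HT HA Ht0 Hx0 HK Hh Hgr HP HM Hm Hr.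
set (P := fun z => (aP + aM) / 2 + (aP - aM) / (2 * h) * z + m / 2 * (z ^ 2 - h ^ 2)).
(* The second pair of variables carries the shift [z]; its time component is a dummy. *)
destruct (usc_sum_max T r h A (fun _ _ => 0)
  (fun t x _ z => - q * t - p * x - (K + 1) * ((t - t0) ^ 2 + (x - x0 - z) ^ 2) - P z))
  as [t1 [x1 [s1 [z1 [[Bt [Bx [Bs Bz]]] Hmax]]]]]; try lra; auto.
{ intros t x _ e He; exists 1; split; [|intros]; simpl; lra. }
{ intros t x s y lt lx ls ly Lt Lx Ls Ly; unfold P; lim_poly. }
assert (Hmax' : forall t x z, 0 <= t <= T -> - r <= x <= r -> - h <= z <= h ->
  A t x - q * t - p * x - (K + 1) * ((t - t0) ^ 2 + (x - x0 - z) ^ 2) - P z <=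
  A t1 x1 - q * t1 - p * x1 - (K + 1) * ((t1 - t0) ^ 2 + (x1 - x0 - z1) ^ 2) - P z1).
{ intros t x z H1 H2 H3; generalize (Hmax t x 0 z H1 H2 ltac:(lra) H3); cbv beta; lra. }
clear Hmax.
assert (HPh : P h = aP) by (unfold P; field; lra).
assert (HPmh : P (- h) = aM) by (unfold P; field; lra).
assert (HP0 : P 0 = (aP + aM) / 2 - m * h ^ 2 / 2) by (unfold P; field; lra).
assert (Hpos : 0 < A t1 x1 - q * t1 - p * x1
  - (K + 1) * ((t1 - t0) ^ 2 + (x1 - x0 - z1) ^ 2) - P z1).
{ generalize (Hmax' t0 x0 0 Ht0 Hx0 ltac:(lra)); rewrite HP0.
  replace ((K + 1) * ((t0 - t0) ^ 2 + (x0 - x0 - 0) ^ 2)) with 0 by ring; lra. }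
assert (Hz1 : - h < z1 < h).
{ destruct (Req_dec z1 h) as [->|N1].
  { generalize (HP t1 x1 Bt Bx); lra. }
  destruct (Req_dec z1 (- h)) as [->|N2].
  { generalize (HM t1 x1 Bt Bx).
    replace (x1 - x0 - - h) with (x1 - x0 + h) in Hpos by ring; lra. }
  lra. }
(* The penalty [K + 1] exceeds twice the growth [K / 2], and [(x1 - x0)^2 <= 2 (x1 - x0 - z1)^2 + 2
   z1^2]; comparison with [(t0, x0, z1)] therefore keeps the maximiser at distance of order [h]. *)
assert (Hloc : (t1 - t0) ^ 2 + (x1 - x0 - z1) ^ 2 <= (2 * K + 1) * z1 ^ 2).
{ generalize (Hmax' t0 x0 z1 Ht0 Hx0 Bz) (Hgr t1 x1 Bt Bx).
  replace ((t0 - t0) ^ 2 + (x0 - x0 - z1) ^ 2) with (z1 ^ 2) by ring.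
  assert (0 <= K / 2 * (x1 - x0 - 2 * z1) ^ 2).
  { apply Rmult_le_pos; [lra | apply pow2_ge_0]. }
  assert (0 <= K / 2 * (t1 - t0) ^ 2).
  { apply Rmult_le_pos; [lra | apply pow2_ge_0]. }
  nra. }
assert (Hz2 : z1 ^ 2 <= h ^ 2) by nra.
assert (Hh2 : (2 * K + 1) * z1 ^ 2 <= ((2 * K + 1) * h) ^ 2).
{ apply Rle_trans with ((2 * K + 1) * h ^ 2).
  { apply Rmult_le_compat_l; lra. }
  assert (0 <= h ^ 2) by apply pow2_ge_0; nra. }
assert (Hkh : 0 <= (2 * K + 1) * h) by (apply Rmult_le_pos; lra).
assert (Dt : Rabs (t1 - t0) <= (2 * K + 1) * h).
{ rewrite <- (Rabs_pos_eq _ Hkh); apply Rsqr_le_abs_0; rewrite !Rsqr_pow2.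
  generalize (pow2_ge_0 (x1 - x0 - z1)); lra. }
assert (Dx : Rabs (x1 - x0 - z1) <= (2 * K + 1) * h).
{ rewrite <- (Rabs_pos_eq _ Hkh); apply Rsqr_le_abs_0; rewrite !Rsqr_pow2.
  generalize (pow2_ge_0 (t1 - t0)); lra. }
assert (Dx' : Rabs (x1 - x0) <= (2 * K + 2) * h).
{ apply Rabs_le; apply Rabs_le_between in Dx; lra. }
exists t1, x1; split; [exact Bt|]; split; [lra|]; split; [exact Dx'|].
exists (q - 2 * (K + 1) * t0), (K + 1), (p + (aP - aM) / (2 * h) + m * (z1 - x1)).
split; [ring|].
apply Rabs_le_between in Dx'.
exists (Rmin (Rmin (h - z1) (z1 + h)) (Rmin (r - x1) (x1 + r))); split.
{ repeat apply Rmin_pos; lra. }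
intros s y Hs _ Hy.
assert (Hy1 := Rlt_le_trans _ _ _ Hy (Rmin_l _ _)).
assert (Hy2 := Rlt_le_trans _ _ _ Hy (Rmin_r _ _)).
assert (Hy3 := Rlt_le_trans _ _ _ Hy1 (Rmin_l _ _)).
assert (Hy4 := Rlt_le_trans _ _ _ Hy1 (Rmin_r _ _)).
assert (Hy5 := Rlt_le_trans _ _ _ Hy2 (Rmin_l _ _)).
assert (Hy6 := Rlt_le_trans _ _ _ Hy2 (Rmin_r _ _)).
apply Rabs_lt_between in Hy3; apply Rabs_lt_between in Hy4.
apply Rabs_lt_between in Hy5; apply Rabs_lt_between in Hy6.
(* Shifting [z] by [y - x1] leaves the space penalty unchanged, so in space only [P] and the tilt
   vary. *)
generalize (Hmax' s y (z1 + y - x1) ltac:(lra) ltac:(lra) ltac:(lra)).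
replace (y - x0 - (z1 + y - x1)) with (x1 - x0 - z1) by ring.
unfold P; cbv beta; intros H.
match type of H with ?a <= ?b => apply Rminus_le; apply Rle_minus in H;
  apply Rle_trans with (2 := H); apply Req_le; field; lra end.
Qed.

(* Weak form of the Crandall-Ishii theorem on sums.  Second differences of the
   sup-convolutions of [A] and [B] at the maximum add up to a nonpositive number;
   touching each of them from above by a chord parabola of slightly larger
   curvature gives the two jets. *)
Lemma theorem_on_sums (T r n t0 x0 s0 y0 d : R) (A B : R -> R -> R) :
  0 <= T -> usc_on T A -> usc_on T B -> 0 < n -> 0 < d ->
  0 <= t0 <= T -> - r < x0 < r -> 0 <= s0 <= T -> - r < y0 < r ->
  (forall t x s y, 0 <= t <= T -> - r <= x <= r -> 0 <= s <= T -> - r <= y <= r ->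
     A t x + B s y - n * (t - s) ^ 2 - n * (x - y) ^ 2 <=
     A t0 x0 + B s0 y0 - n * (t0 - s0) ^ 2 - n * (x0 - y0) ^ 2) ->
  exists t1 x1 q1 M1 s1 y1 q2 M2,
    (0 <= t1 /\ Rabs (t1 - t0) < d /\ Rabs (x1 - x0) < d /\ quad_jet T A t1 x1 q1 M1) /\
    (0 <= s1 /\ Rabs (s1 - s0) < d /\ Rabs (y1 - y0) < d /\ quad_jet T B s1 y1 q2 M2) /\
    Rabs (q1 + q2) < d /\ M1 + M2 <= d.
Proof.
intros HT HA HB Hn Hd Ht0 Hx0 Hs0 Hy0 Hmax.
(* [q] and [p] are the slopes of the doubling penalty at the maximum; freezing one pair of variables
   there bounds the growth of the other function by [n = K / 2]. *)
set (K := 2 * n); set (q := 2 * n * (t0 - s0)); set (p := 2 * n * (x0 - y0)).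
assert (HK : 0 < 2 * K + 2) by (unfold K; lra).
assert (Hpos : 0 < Rmin (Rmin d (Rmin (r - x0) (x0 + r))) (Rmin (r - y0) (y0 + r))).
{ repeat apply Rmin_pos; lra. }
set (mu := Rmin _ _) in Hpos.
assert (Hmu : mu <= d /\ mu <= r - x0 /\ mu <= x0 + r /\ mu <= r - y0 /\ mu <= y0 + r).
{ unfold mu, Rmin; repeat destruct (Rle_dec _ _); lra. }
clearbody mu.
(* One factor [2 * K + 2] comes from the displacement of the maximisers, the other from
   differentiating the time penalty in the bound on [q1 + q2]. *)
set (h := mu / (4 * ((2 * K + 2) * (2 * K + 2)))).
assert (Hh : 0 < h).
{ apply Rdiv_lt_0_compat; [lra|]; apply Rmult_lt_0_compat; [lra|].
  apply Rmult_lt_0_compat; lra. }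
assert (HKh' : 4 * ((2 * K + 2) * ((2 * K + 2) * h)) = mu) by (unfold h; field; lra).
assert (HKh : (2 * K + 2) * h < mu).
{ assert (0 < (2 * K + 2) * h) by (apply Rmult_lt_0_compat; lra).
  assert (2 < 2 * K + 2) by (unfold K; lra); nra. }
(* The common shift [z] cancels in the difference of the space increments, and
   [(a - b)^2 <= 2 a^2 + 2 b^2] splits the coupling into separate penalties. *)
assert (Hmaxseparated : forall z t x s y,
  0 <= t <= T -> - r <= x <= r -> 0 <= s <= T -> - r <= y <= r ->
  (A t x - q * t - p * x - (K + 1) * ((t - t0) ^ 2 + (x - x0 - z) ^ 2)) +
  (B s y - - q * s - - p * y - (K + 1) * ((s - s0) ^ 2 + (y - y0 - z) ^ 2)) <=
  (A t0 x0 - q * t0 - p * x0) + (B s0 y0 - - q * s0 - - p * y0)).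
{ intros z t x s y H1 H2 H3 H4; generalize (Hmax t x s y H1 H2 H3 H4); unfold K, q, p; intros H.
  assert (0 <= n * ((t - t0) + (s - s0)) ^ 2) by (apply Rmult_le_pos; [lra | apply pow2_ge_0]).
  assert (0 <= n * ((x - x0 - z) + (y - y0 - z)) ^ 2) by (apply Rmult_le_pos; [lra | apply pow2_ge_0]).
  generalize (pow2_ge_0 (t - t0)) (pow2_ge_0 (s - s0)) (pow2_ge_0 (x - x0 - z)) (pow2_ge_0 (y - y0 - z)).
  intros; lra. }
assert (HgA : forall t x, 0 <= t <= T -> - r <= x <= r ->
     A t x - q * t - p * x <=
     A t0 x0 - q * t0 - p * x0 + K / 2 * ((t - t0) ^ 2 + (x - x0) ^ 2)).
{ intros t x H1 H2; generalize (Hmax t x s0 y0 H1 H2 Hs0 ltac:(lra)); unfold K, q, p; intros; lra. }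
assert (HgB : forall s y, 0 <= s <= T -> - r <= y <= r ->
     B s y - - q * s - - p * y <=
     B s0 y0 - - q * s0 - - p * y0 + K / 2 * ((s - s0) ^ 2 + (y - y0) ^ 2)).
{ intros s y H1 H2; generalize (Hmax t0 x0 s y Ht0 ltac:(lra) H1 H2); unfold K, q, p; intros; lra. }
assert (Hsup : forall z, exists a b,
  (forall t x, 0 <= t <= T -> - r <= x <= r ->
     A t x - q * t - p * x - (K + 1) * ((t - t0) ^ 2 + (x - x0 - z) ^ 2) <= a) /\
  (forall s y, 0 <= s <= T -> - r <= y <= r ->
     B s y - - q * s - - p * y - (K + 1) * ((s - s0) ^ 2 + (y - y0 - z) ^ 2) <= b) /\
  a + b <= (A t0 x0 - q * t0 - p * x0) + (B s0 y0 - - q * s0 - - p * y0)).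
{ intros z.
  destruct (usc_sum_max T r r A B (fun t x s y =>
    (- q * t - p * x - (K + 1) * ((t - t0) ^ 2 + (x - x0 - z) ^ 2)) +
    (- - q * s - - p * y - (K + 1) * ((s - s0) ^ 2 + (y - y0 - z) ^ 2))))
    as [t2 [x2 [s2 [y2 [[H1 [H2 [H3 H4]]] Hm]]]]]; auto; try lra.
  { intros t x s y lt lx ls ly Lt Lx Ls Ly; lim_poly. }
  exists (A t2 x2 - q * t2 - p * x2 - (K + 1) * ((t2 - t0) ^ 2 + (x2 - x0 - z) ^ 2)).
  exists (B s2 y2 - - q * s2 - - p * y2 - (K + 1) * ((s2 - s0) ^ 2 + (y2 - y0 - z) ^ 2)).
  split; [|split].
  - intros t x Ht Hx; generalize (Hm t x s2 y2 Ht Hx H3 H4); lra.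
  - intros s y Hs Hy; generalize (Hm t2 x2 s y H1 H2 Hs Hy); lra.
  - auto. }
destruct (Hsup h) as [aP [bP [HaP [HbP HabP]]]].
destruct (Hsup (- h)) as [aM [bM [HaM [HbM HabM]]]].
set (a0 := A t0 x0 - q * t0 - p * x0) in *.
set (b0 := B s0 y0 - - q * s0 - - p * y0) in *.
assert (Hh2 : 0 < h ^ 2) by (apply pow_lt; exact Hh).
assert (Hcurv : forall u, u < (u / h ^ 2 + d / 2) * h ^ 2).
{ intros u; replace ((u / h ^ 2 + d / 2) * h ^ 2) with (u + d / 2 * h ^ 2) by (field; lra).
  assert (0 < d / 2 * h ^ 2) by (apply Rmult_lt_0_compat; lra); lra. }
destruct (quad_jet_of_sup_conv T r t0 x0 q p K h ((aP + aM - 2 * a0) / h ^ 2 + d / 2) aP aM A)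
  as [t1 [x1 [Bt1 [Dt1 [Dx1 J1]]]]]; auto; try lra; try (unfold K; lra).
{ intros t x H1 H2; replace (x - x0 + h) with (x - x0 - - h) by ring; auto. }
destruct (quad_jet_of_sup_conv T r s0 y0 (- q) (- p) K h ((bP + bM - 2 * b0) / h ^ 2 + d / 2) bP bM B)
  as [s1 [y1 [Bs1 [Ds1 [Dy1 J2]]]]]; auto; try lra; try (unfold K; lra).
{ intros t x H1 H2; replace (x - y0 + h) with (x - y0 - - h) by ring; auto. }
exists t1, x1, (q + 2 * (K + 1) * (t1 - t0)), ((aP + aM - 2 * a0) / h ^ 2 + d / 2).
exists s1, y1, (- q + 2 * (K + 1) * (s1 - s0)), ((bP + bM - 2 * b0) / h ^ 2 + d / 2).
split; [|split; [|split]].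
- repeat split; try lra; exact J1.
- repeat split; try lra; exact J2.
- replace (q + 2 * (K + 1) * (t1 - t0) + (- q + 2 * (K + 1) * (s1 - s0)))
    with ((2 * K + 2) * (t1 - t0) + (2 * K + 2) * (s1 - s0)) by ring.
  apply Rabs_le_between in Dt1; apply Rabs_le_between in Ds1.
  apply Rabs_lt_between; split; nra.
- apply Rplus_le_reg_r with (- d).
  replace (_ + _ + - d) with ((aP + bP + (aM + bM) - 2 * (a0 + b0)) * / h ^ 2) by (field; lra).
  replace (d + - d) with (0 * / h ^ 2) by ring.
  apply Rmult_le_compat_r; [|lra].
  apply Rlt_le, Rinv_0_lt_compat; exact Hh2.
Qed.

(** * From quadratic jets to the viscosity inequalities *)

Lemma C12_quadratic (a b c m : R) :
  let phi := fun s y => a * s + b * s ^ 2 + c * y + m / 2 * y ^ 2 in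
  C12 phi /\ (forall t x, dt phi t x = a + 2 * b * t) /\ (forall t x, dxx phi t x = m).
Proof.
intros phi.
assert (Dt : forall t x, is_derive (fun s => phi s x) t (a + 2 * b * t)).
{ intros t x; unfold phi; auto_derive; [trivial | ring]. }
assert (Dx : forall t x, is_derive (fun y => phi t y) x (c + m * x)).
{ intros t x; unfold phi; auto_derive; [trivial | field]. }
assert (Dx' : forall t x, Derive (fun y => phi t y) x = c + m * x).
{ intros t x; apply is_derive_unique, Dx. }
assert (Dxx : forall t x, is_derive (fun y => Derive (fun z => phi t z) y) x m).
{ intros t x; apply (is_derive_ext (fun y => c + m * y)).
  { intros y; symmetry; apply Dx'. }
  auto_derive; [trivial | ring]. }
assert (Et : forall t x, dt phi t x = a + 2 * b * t).
{ intros t x; apply is_derive_unique, Dt. }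
assert (Exx : forall t x, dxx phi t x = m).
{ intros t x; apply is_derive_unique, Dxx. }
split; [|tauto].
assert (Cmult : forall (u v : R * R -> R) p, continuous u p -> continuous v p ->
  continuous (fun z => u z * v z) p) by (intros; apply (continuous_mult u v); assumption).
assert (Cplus : forall (u v : R * R -> R) p, continuous u p -> continuous v p ->
  continuous (fun z => u z + v z) p) by (intros; apply (continuous_plus u v); assumption).
assert (Cfst : forall p : R * R, continuous (fun z : R * R => fst z) p) by (intros []; apply continuous_fst).
assert (Csnd : forall p : R * R, continuous (fun z : R * R => snd z) p) by (intros []; apply continuous_snd).
assert (Cc : forall (k : R) (p : R * R), continuous (fun z : R * R => k) p) by (intros; apply continuous_const).
repeat split.
- intros t x; eexists; apply Dt.
- intros t x; eexists; apply Dx.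
- intros t x; eexists; apply Dxx.
- unfold phi, pow; auto 20.
- apply (continuous_ext (fun z => a + 2 * b * fst z)); [intros; symmetry; apply Et | auto].
- apply (continuous_ext (fun z => c + m * snd z)); [intros; symmetry; apply Dx' | auto].
- apply (continuous_ext (fun z => m)); [intros; symmetry; apply Exx | auto].
Qed.

Lemma visc_subsol_quad_jet (T eps : R) (kappa sigma f gbar : R -> R) (U : R -> R -> R) (t x q M : R) :
  visc_subsol T eps kappa sigma f gbar U -> 0 <= t < T -> quad_jet T U t x q M ->
  F_le0 eps kappa sigma f gbar x q M.
Proof.
intros [_ HU] Ht [a [b [c [-> Hmax]]]].
destruct (C12_quadratic a b c M) as [H1 [H2 H3]].
generalize (HU _ t x H1 Ht Hmax); rewrite H2, H3; trivial.
Qed.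

Lemma visc_supersol_quad_jet (T eps : R) (kappa sigma f gbar : R -> R) (V : R -> R -> R) (t x q M : R) :
  visc_supersol T eps kappa sigma f gbar V -> 0 <= t < T ->
  quad_jet T (fun s y => - V s y) t x q M ->
  F_ge0 eps kappa sigma f gbar x (- q) (- M).
Proof.
intros [_ HV] Ht [a [b [c [-> [d [Hd Hmax]]]]]].
destruct (C12_quadratic (- a) (- b) (- c) (- M)) as [H1 [H2 H3]].
replace (- (a + 2 * b * t)) with (- a + 2 * - b * t) by ring.
generalize (HV _ t x H1 Ht); rewrite H2, H3; intros H; apply H; clear H.
exists d; split; [exact Hd|]; intros s y Hs Hst Hy.
generalize (Hmax s y Hs Hst Hy); lra.
Qed.

(** The penalty is itself a quadratic polynomial, with time derivative [- a] and second space
    derivative [c], so it can be moved into the test function. *)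
Lemma quad_jet_penalized (T l u a c b : R) (V : R -> R -> R) (t x q M : R) :
  0 < l ->
  quad_jet T (fun s y => - (l * V s y + u * (a * (T - s) + c / 2 * y ^ 2 + b))) t x q M ->
  quad_jet T (fun s y => - V s y) t x ((q - u * a) / l) ((M + u * c) / l).
Proof.
intros Hl [a' [b' [c' [-> [d [Hd Hmax]]]]]].
exists ((a' - u * a) / l), (b' / l), (c' / l); split; [field; lra|].
exists d; split; [exact Hd|]; intros s y Hs Hst Hy.
generalize (Hmax s y Hs Hst Hy); intros H.
apply Rmult_le_reg_l with (1 := Hl); apply Rminus_le; apply Rle_minus in H.
apply Rle_trans with (2 := H); apply Req_le; field; lra.
Qed.

(** * The nonlinearity and the contradiction between strict jets *)

Lemma nonlinearity_le (f M N : R) : f * N < 1 -> M <= N -> 0 < f ->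
  M / (1 - f * M) <= N / (1 - f * N).
Proof.
intros HN HM Hf.
assert (f * M <= f * N) by nra.
apply Rminus_le.
replace (_ - _) with ((M - N) / ((1 - f * M) * (1 - f * N))) by (field; lra).
apply Rmult_le_reg_r with ((1 - f * M) * (1 - f * N)); [apply Rmult_lt_0_compat; lra|].
unfold Rdiv; rewrite Rmult_assoc, Rinv_l, Rmult_0_l; [lra|].
apply Rgt_not_eq, Rmult_lt_0_compat; lra.
Qed.

(** The gap between the two sides is [l (1 - l) f (M - N)^2] divided by a product of positive
    factors. This convexity is what makes the operator concave. *)
Lemma nonlinearity_convex (f M N l : R) : 0 < f -> f * M < 1 -> f * N < 1 -> 0 <= l <= 1 ->
  (l * M + (1 - l) * N) / (1 - f * (l * M + (1 - l) * N)) <=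
  l * (M / (1 - f * M)) + (1 - l) * (N / (1 - f * N)).
Proof.
intros Hf HM HN Hl.
set (P := l * M + (1 - l) * N).
assert (HP : f * P < 1).
{ assert (0 <= (1 - l) * (1 - f * N)) by (apply Rmult_le_pos; lra).
  unfold P; destruct (Req_dec l 0) as [->|Hl0]; [lra|].
  assert (0 < l * (1 - f * M)) by (apply Rmult_lt_0_compat; lra); lra. }
apply Rminus_le.
replace (_ - _) with (- (l * (1 - l) * f * (M - N) ^ 2) * / ((1 - f * P) * ((1 - f * M) * (1 - f * N)))).
2: { assert (1 - f * P <> 0) by lra; unfold P in *; field; repeat split; lra. }
assert (0 < / ((1 - f * P) * ((1 - f * M) * (1 - f * N)))).
{ apply Rinv_0_lt_compat; repeat apply Rmult_lt_0_compat; lra. }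
assert (0 <= l * (1 - l) * f * (M - N) ^ 2).
{ apply Rmult_le_pos; [repeat apply Rmult_le_pos; lra | apply pow2_ge_0]. }
nra.
Qed.

(** Written as [(1 / (1 - f N) - 1) / f], the nonlinearity stays bounded as [N] tends to minus
    infinity, so no lower bound on curvatures is needed. *)
Lemma nonlinearity_bound (f c d N : R) : 0 < c <= f -> 0 < d <= 1 - f * N ->
  Rabs (N / (1 - f * N)) <= / c * (1 + / d).
Proof.
intros Hf Hd.
replace (N / (1 - f * N)) with (/ f * (/ (1 - f * N) - 1)) by (field; lra).
rewrite Rabs_mult, (Rabs_pos_eq (/ f)); [|apply Rlt_le, Rinv_0_lt_compat; lra].
assert (0 < / (1 - f * N)) by (apply Rinv_0_lt_compat; lra).
assert (/ (1 - f * N) <= / d) by (apply Rinv_le_contravar; lra).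
apply Rmult_le_compat; try apply Rabs_pos.
- apply Rlt_le, Rinv_0_lt_compat; lra.
- apply Rinv_le_contravar; lra.
- apply Rabs_le; lra.
Qed.

(* [q] and [M] are the time derivative and curvature of a jet of [U], [p] and [N] those
   of a jet of [V]; the added terms come from [a (T - t) + (c/2) x^2 + b] with
   [a = Cs iota + 1] and [c = iota/2], for which [gbar - c >= iota/2] and
   [a - sigma^2 c / (2 (1 - f c)) >= 1]. *)
Lemma no_crossing (iota cf Cs u : R) :
  0 < iota -> 0 < cf -> 0 < Cs -> 0 < u < 1 ->
  exists e, 0 < e /\
  forall s1 s2 f1 f2 g1 g2 q p M N,
    0 <= s1 <= Cs -> 0 <= s2 <= Cs -> cf <= f1 -> cf <= f2 ->
    iota <= g1 <= / f1 - iota -> iota <= g2 <= / f2 - iota ->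
    Rabs (s1 - s2) <= e -> Rabs (f1 - f2) <= e -> Rabs (g1 - g2) <= e ->
    Rmin (- q - (s1 * M) / (2 * (1 - f1 * M))) (g1 - M) <= 0 ->
    0 <= Rmin (- p - (s2 * N) / (2 * (1 - f2 * N))) (g2 - N) ->
    q <= (1 - u) * p - u * (Cs * iota + 1) + e ->
    M <= (1 - u) * N + u * (iota / 2) + e ->
    False.
Proof.
intros Hi Hcf HCs Hu.
(* [d] bounds [1 - f * K] from below for every curvature [K <= gbar]; [X] is the resulting bound on
   the nonlinearity. *)
set (d := iota * cf); set (X := / cf * (1 + / d)).
assert (Hd : 0 < d) by (apply Rmult_lt_0_compat; assumption).
assert (HX : 0 < X).
{ apply Rmult_lt_0_compat; [apply Rinv_0_lt_compat; lra|].
  generalize (Rinv_0_lt_compat _ Hd); lra. }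
assert (Ed : d = iota * cf) by reflexivity; assert (EX : X = / cf * (1 + / d)) by reflexivity.
clearbody X; clearbody d.
(* The coefficients of [e] in twice the final inequality: the errors in the time derivative, in
   [sigma^2], in [f] and in the curvature. *)
set (C := 2 + X + Cs * (X * X) + Cs * / (d * d)).
assert (HC : 0 < C).
{ assert (0 < Cs * (X * X)) by (repeat apply Rmult_lt_0_compat; lra).
  assert (0 < / (d * d)) by (apply Rinv_0_lt_compat; apply Rmult_lt_0_compat; lra).
  assert (0 < Cs * / (d * d)) by (apply Rmult_lt_0_compat; lra).
  unfold C; lra. }
set (e := Rmin (u * iota / 8) (u / (2 * C))).
assert (He : 0 < e).
{ apply Rmin_pos.
  - assert (0 < u * iota) by (apply Rmult_lt_0_compat; lra); lra.
  - apply Rdiv_lt_0_compat; lra. }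
exists e; split; [exact He|].
assert (He1 : e <= u * iota / 8) by apply Rmin_l.
assert (He2 : e * C <= u / 2).
{ apply Rle_trans with (u / (2 * C) * C).
  - apply Rmult_le_compat_r; [lra | apply Rmin_r].
  - apply Req_le; field; lra. }

clearbody e.
intros s1 s2 f1 f2 g1 g2 q p M N Hs1 Hs2 Hf1 Hf2 Hg1 Hg2 Ds Df Dg HU HV Hq HM.
apply Rabs_le_between in Ds; apply Rabs_le_between in Df; apply Rabs_le_between in Dg.
assert (Hgap : forall f g K, cf <= f -> g <= / f - iota -> K <= g -> d <= 1 - f * K).
{ intros f g K H1 H2 H3.
  assert (f * K <= f * (/ f - iota)) by (apply Rmult_le_compat_l; lra).
  replace (f * (/ f - iota)) with (1 - f * iota) in H by (field; lra).
  assert (iota * cf <= iota * f) by (apply Rmult_le_compat_l; lra).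
  lra. }
assert (HVN : N <= g2) by (generalize (Rle_trans _ _ _ HV (Rmin_r _ _)); lra).
assert (HVp := Rle_trans _ _ _ HV (Rmin_l _ _)).
set (N' := (1 - u) * N + u * (iota / 2)) in *.
(* Since [N <= g2] and [iota <= g2], the average [N'] is at least [u * iota / 2] below [g2]. Of the
   margin [3 * e], one [e] covers the error in [M], one the change from [g2] to [g1], and the last
   makes [M < g1] strict. *)
assert (HN' : N' + 3 * e <= g2) by (unfold N'; nra).
destruct (Rle_dec g1 M) as [HgM|HgM]; [lra|].
assert (HUq : - q - (s1 * M) / (2 * (1 - f1 * M)) <= 0).
{ revert HU; unfold Rmin; destruct (Rle_dec _ _); lra. }
clear HU HV.
(* [Z] dominates [M], stays below [g1] and [g2], and exceeds [N'] by exactly [e]: the nonlinearity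
   passes from [f1] to [f2] at [Z], then from [Z] to [N'], where convexity splits it. *)
set (Z := N' + e).
assert (Z1 : d <= 1 - f1 * Z) by (apply (Hgap f1 g1); unfold Z; lra).
assert (Z2 : d <= 1 - f2 * Z) by (apply (Hgap f2 g2); unfold Z; lra).
assert (N2 : d <= 1 - f2 * N) by (apply (Hgap f2 g2); lra).
assert (N2' : d <= 1 - f2 * N') by (apply (Hgap f2 g2); lra).
assert (I2 : d <= 1 - f2 * (iota / 2)) by (apply (Hgap f2 g2); lra).
assert (M1 : d <= 1 - f1 * M) by (apply (Hgap f1 g1); lra).
assert (BX1 := nonlinearity_bound f1 cf d Z ltac:(lra) ltac:(lra)); rewrite <- EX in BX1.
assert (BX2 := nonlinearity_bound f2 cf d Z ltac:(lra) ltac:(lra)); rewrite <- EX in BX2.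
assert (L1 := nonlinearity_le f1 M Z ltac:(lra) ltac:(unfold Z; lra) ltac:(lra)).
assert (L2 := nonlinearity_convex f2 N (iota / 2) (1 - u) ltac:(lra) ltac:(lra) ltac:(lra) ltac:(lra)).
replace (1 - (1 - u)) with u in L2 by ring; fold N' in L2.
assert (L3 : Z / (1 - f1 * Z) - Z / (1 - f2 * Z) <= X * X * e).
{ replace (_ - _) with ((Z / (1 - f1 * Z)) * (Z / (1 - f2 * Z)) * (f1 - f2)) by (field; lra).
  apply Rle_trans with (1 := Rle_abs _); rewrite !Rabs_mult.
  apply Rmult_le_compat; try apply Rabs_pos.
  - apply Rmult_le_pos; apply Rabs_pos.
  - apply Rmult_le_compat; try apply Rabs_pos; assumption.
  - apply Rabs_le; lra. }
assert (L4 : Z / (1 - f2 * Z) - N' / (1 - f2 * N') <= / (d * d) * e).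
{ replace (_ - _) with (/ ((1 - f2 * Z) * (1 - f2 * N')) * e) by (unfold Z in *; field; lra).
  apply Rmult_le_compat_r; [lra|]; apply Rinv_le_contravar.
  - apply Rmult_lt_0_compat; lra.
  - apply Rmult_le_compat; lra. }
assert (L5 : (iota / 2) / (1 - f2 * (iota / 2)) <= iota).
{ assert (f2 * iota <= 1 - f2 * iota).
  { apply Rle_trans with (f2 * (/ f2 - iota)).
    - apply Rmult_le_compat_l; lra.
    - apply Req_le; field; lra. }
  apply Rmult_le_reg_r with (1 - f2 * (iota / 2)); [lra|].
  unfold Rdiv at 1; rewrite Rmult_assoc, Rinv_l; [|lra].
  assert (0 <= iota * (1 - f2 * iota)) by (apply Rmult_le_pos; lra); lra. }
assert (E1 : s1 * M / (2 * (1 - f1 * M)) = s1 * (M / (1 - f1 * M)) / 2) by (field; lra).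
assert (E2 : s2 * N / (2 * (1 - f2 * N)) = s2 * (N / (1 - f2 * N)) / 2) by (field; lra).
rewrite E1 in HUq; rewrite E2 in HVp.
set (x1 := M / (1 - f1 * M)) in *; set (x2 := Z / (1 - f1 * Z)) in *.
set (x3 := Z / (1 - f2 * Z)) in *; set (x4 := N' / (1 - f2 * N')) in *.
set (x5 := N / (1 - f2 * N)) in *; set (x6 := (iota / 2) / (1 - f2 * (iota / 2))) in *.
assert (S1 : s1 * x1 <= s1 * (x3 + X * X * e)) by (apply Rmult_le_compat_l; lra).
assert (S2 : s1 * (X * X * e) <= Cs * (X * X * e)).
{ apply Rmult_le_compat_r; [|lra]; repeat apply Rmult_le_pos; lra. }
assert (S3 : (s1 - s2) * x3 <= e * X).
{ apply Rle_trans with (1 := Rle_abs _); rewrite Rabs_mult.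
  apply Rmult_le_compat; try apply Rabs_pos; [apply Rabs_le; lra | exact BX2]. }
assert (S4 : s2 * x3 <= s2 * (((1 - u) * x5 + u * x6) + / (d * d) * e)) by (apply Rmult_le_compat_l; lra).
assert (S5 : s2 * (/ (d * d) * e) <= Cs * (/ (d * d) * e)).
{ apply Rmult_le_compat_r; [|lra]; apply Rmult_le_pos; [|lra].
  apply Rlt_le, Rinv_0_lt_compat, Rmult_lt_0_compat; lra. }
assert (S6 : s2 * x6 <= Cs * iota).
{ apply Rle_trans with (s2 * iota).
  - apply Rmult_le_compat_l; lra.
  - apply Rmult_le_compat_r; lra. }
assert (S7 : u * (s2 * x6) <= u * (Cs * iota)) by (apply Rmult_le_compat_l; lra).
assert (S8 : (1 - u) * (s2 * x5) <= (1 - u) * (- 2 * p)) by (apply Rmult_le_compat_l; lra).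
assert (S9 : 0 < u * (Cs * iota)) by (repeat apply Rmult_lt_0_compat; lra).
unfold C in He2; lra.
Qed.

(** * Boundedness and continuity of the sets [D] *)

(** Far to the right [c * x + d] has constant sign, so for nonzero [c] the number [Rabs c] is itself
    a value of the derivative and inherits the strict bound. *)
Lemma slope_lt_of_derive (k : R -> R) (a c d L : R) :
  0 < L -> (forall x, a <= x -> k x = Rabs (c * x + d) + 1) ->
  (forall x, Rabs (Derive k x) < L) -> Rabs c < L.
Proof.
intros HL.
assert (Hpos : forall c d, 0 < c -> (forall x, a <= x -> k x = Rabs (c * x + d) + 1) ->
  (forall x, Rabs (Derive k x) < L) -> c < L).
{ clear c d; intros c d Hc Hk HD.
  set (b := Rmax a (Rabs d / c)).
  assert (Hb : forall x, b < x -> k x = c * x + d + 1).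
  { intros x Hx.
    assert (Ha := Rle_lt_trans _ _ _ (Rmax_l _ _) Hx).
    assert (Hd := Rle_lt_trans _ _ _ (Rmax_r _ _) Hx).
    rewrite Hk by lra; rewrite Rabs_pos_eq; [reflexivity|].
    apply (Rmult_lt_compat_l c) in Hd; [|exact Hc].
    replace (c * (Rabs d / c)) with (Rabs d) in Hd by (field; lra).
    generalize (Rle_abs (- d)); rewrite Rabs_Ropp; lra. }
  assert (HE : is_derive k (b + 1) c).
  { apply (is_derive_ext_loc (fun x => c * x + d + 1)).
    - exists (mkposreal 1 Rlt_0_1); intros x Hx; symmetry; apply Hb.
      apply Rabs_lt_between in Hx; simpl in Hx.
      unfold minus, plus, opp in Hx; simpl in Hx; lra.
    - auto_derive; [trivial | ring]. }
  generalize (HD (b + 1)); rewrite (is_derive_unique _ _ _ HE).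
  rewrite Rabs_pos_eq; lra. }
intros Hk HD; destruct (Rtotal_order c 0) as [Hc|[->|Hc]].
- rewrite Rabs_left by exact Hc; apply (Hpos (- c) (- d)); auto; [lra|].
  intros x Hx; rewrite Hk by exact Hx; f_equal.
  rewrite <- Rabs_Ropp; f_equal; ring.
- rewrite Rabs_R0; exact HL.
- rewrite Rabs_pos_eq by lra; apply (Hpos c d); auto.
Qed.

(** To the right, [eps0 * k] grows with slope strictly below 1, so a large [z] cannot lie within
    [eps0 * k z] of a bounded [x]. *)
Lemma right_bound_of_slope (k : R -> R) (a c d eps0 r : R) :
  0 < eps0 -> 0 < a -> (forall x, a <= x -> k x = Rabs (c * x + d) + 1) ->
  (forall x, Rabs (Derive k x) < / eps0) ->
  exists b, forall x z, Rabs x <= r -> Rabs (x - z) <= eps0 * k z -> z <= b.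
Proof.
intros He Ha Hk HD.
assert (Hc : Rabs c < / eps0).
{ apply (slope_lt_of_derive k a c d); auto; apply Rinv_0_lt_compat; exact He. }
apply (Rmult_lt_compat_l eps0) in Hc; [|exact He]; rewrite Rinv_r in Hc; [|lra].
exists (Rmax a ((r + eps0 * (Rabs d + 1)) / (1 - eps0 * Rabs c))); intros x z Hx Hz.
destruct (Rle_dec a z) as [Haz|Haz]; [|apply Rle_trans with (2 := Rmax_l _ _); lra].
apply Rle_trans with (2 := Rmax_r _ _).
rewrite Hk in Hz by exact Haz.
apply Rmult_le_reg_r with (1 - eps0 * Rabs c); [lra|].
replace ((r + eps0 * (Rabs d + 1)) / (1 - eps0 * Rabs c) * (1 - eps0 * Rabs c))
  with (r + eps0 * (Rabs d + 1)) by (field; lra).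
assert (Htri := Rabs_triang (c * z) d); rewrite Rabs_mult, (Rabs_pos_eq z) in Htri by lra.
apply (Rmult_le_compat_l eps0) in Htri; [|lra].
apply Rabs_le_between in Hz; apply Rabs_le_between in Hx; lra.
Qed.

Lemma inD_iff (eps x z : R) (kappa : R -> R) : 0 < kappa z ->
  inD eps kappa x z <-> Rabs (x - z) <= eps * kappa z.
Proof.
intros Hk; unfold inD; split.
- intros [H1 H2]; apply Rabs_le; split.
  + apply (Rmult_le_compat_r (kappa z)) in H1; [|lra].
    replace ((x - z) / kappa z * kappa z) with (x - z) in H1 by (field; lra); lra.
  + apply (Rmult_le_compat_r (kappa z)) in H2; [|lra].
    replace ((x - z) / kappa z * kappa z) with (x - z) in H2 by (field; lra); lra.
- intros H; apply Rabs_le_between in H; split; apply Rmult_le_reg_r with (kappa z); try lra.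
  + replace ((x - z) / kappa z * kappa z) with (x - z) by (field; lra); lra.
  + replace ((x - z) / kappa z * kappa z) with (x - z) by (field; lra); lra.
Qed.

(* [inD eps kappa x z] says that [x = z + theta * kappa z] with [|theta| <= eps];
   for fixed [theta] this map is increasing in [z], so that [y] close to [x] has a
   preimage close to [z]. *)
Lemma inD_lower_semicontinuous (eps0 eps xK r : R) (kappa ghat : R -> R) :
  0 < eps0 -> 0 <= eps <= eps0 -> 0 < xK ->
  affine_right_of ghat xK -> affine_left_of ghat xK ->
  Cinf_bdd_derivs kappa -> (forall x, 0 < kappa x) ->
  (forall x, (x <= - xK \/ xK <= x) -> kappa x = Rabs (ghat x) + 1) ->
  (forall x, - / eps0 < Derive kappa x < / eps0) ->
  exists b, forall rho, 0 < rho -> exists d, 0 < d /\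
    forall x y z, Rabs x <= r -> Rabs (x - y) < d -> inD eps kappa x z ->
      Rabs z <= b /\ exists z', inD eps kappa y z' /\ Rabs (z - z') <= rho.
Proof.
intros He0 He HxK [cr [dr Hr]] [cl [dl Hl]] [Hsm _] Hpos Hout HD.
assert (HD' : forall x, Rabs (Derive kappa x) < / eps0) by (intros x; apply Rabs_lt_between, HD).
destruct (right_bound_of_slope kappa xK cr dr eps0 r) as [b1 Hb1]; auto.
{ intros x Hx; rewrite Hout, Hr; auto. }
(* The bound from below follows by reflection. *)
destruct (right_bound_of_slope (fun x => kappa (- x)) xK (- cl) dl eps0 r) as [b2 Hb2]; auto.
{ intros x Hx; rewrite Hout, Hl by lra; f_equal; f_equal; ring. }
{ intros x; replace (Derive _ x) with (- Derive kappa (- x)); [rewrite Rabs_Ropp; auto|].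
  symmetry; apply is_derive_unique.
  auto_derive; [apply (Hsm 0%nat) | change (Derive (fun u => kappa u)) with (Derive kappa); ring]. }
set (b := Rabs b1 + Rabs b2).
assert (Hbound : forall x z, Rabs x <= r -> inD eps kappa x z -> Rabs z <= b).
{ intros x z Hx Hz; apply inD_iff in Hz; [|apply Hpos].
  assert (Hz0 : Rabs (x - z) <= eps0 * kappa z).
  { apply Rle_trans with (1 := Hz), Rmult_le_compat_r; [apply Rlt_le, Hpos | lra]. }
  assert (H1 := Hb1 x z Hx Hz0).
  assert (H2 : - z <= b2).
  { apply (Hb2 (- x) (- z)); [rewrite Rabs_Ropp; exact Hx|].
    rewrite Ropp_involutive; replace (- x - - z) with (- (x - z)) by ring.
    rewrite Rabs_Ropp; exact Hz0. }
  generalize (Rle_abs b1) (Rle_abs b2) (Rabs_pos b1) (Rabs_pos b2); intros.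
  apply Rabs_le; unfold b; lra. }
assert (Hb0 : 0 <= b) by (unfold b; generalize (Rabs_pos b1) (Rabs_pos b2); lra).
(* Compactness turns the pointwise strict bound on the derivative into [eps0 * k0 < 1], which also
   covers [eps = eps0]. The radius [b + 1] leaves room for [z - rh] and [z + rh]. *)
destruct (continuity_ab_maj (fun x => Rabs (Derive kappa x)) (- (b + 1)) (b + 1)) as [xm [Hxm _]].
{ lra. }
{ intros x _; apply continuity_pt_filterlim.
  apply (continuous_comp (Derive kappa) Rabs); [|apply continuous_Rabs].
  apply (ex_derive_continuous (Derive kappa)), (Hsm 1%nat). }
set (k0 := Rabs (Derive kappa xm)) in *.
assert (Hk0 : eps0 * k0 < 1).
{ rewrite <- (Rinv_r eps0) by lra; apply Rmult_lt_compat_l; [exact He0 | apply HD']. }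
exists b; intros rho Hrho.
set (rh := Rmin rho 1).
assert (Hrh : 0 < rh /\ rh <= rho /\ rh <= 1).
{ split; [apply Rmin_pos; lra | split; [apply Rmin_l | apply Rmin_r]]. }
exists ((1 - eps0 * k0) * rh); split; [apply Rmult_lt_0_compat; lra|].
intros x y z Hx Hxy Hz.
assert (Hzb := Hbound x z Hx Hz); split; [exact Hzb|].
set (th := (x - z) / kappa z).
assert (Hth : Rabs th <= eps) by (apply Rabs_le; exact Hz).
assert (Hthz : z + th * kappa z = x) by (unfold th; field; apply Rgt_not_eq, Hpos).
apply Rabs_le_between in Hzb.
assert (Hinc : forall u v, - (b + 1) <= u -> u <= v -> v <= b + 1 ->
  (1 - eps0 * k0) * (v - u) <= (v + th * kappa v) - (u + th * kappa u)).
{ intros u v Hu Huv Hv.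
  destruct (MVT_gen kappa u v (Derive kappa)) as [w [Hw Hwe]].
  - intros w _; apply Derive_correct, (Hsm 0%nat).
  - intros w _; apply continuity_pt_filterlim, (ex_derive_continuous kappa), (Hsm 0%nat).
  - rewrite Rmin_left, Rmax_right in Hw by exact Huv.
    replace (v + th * kappa v - (u + th * kappa u))
      with ((1 + th * Derive kappa w) * (v - u)).
    2: { replace (th * kappa v) with (th * (kappa u + Derive kappa w * (v - u))).
         2: { f_equal; lra. }
         ring. }
    apply Rmult_le_compat_r; [lra|].
    assert (Hm : Rabs (th * Derive kappa w) <= eps0 * k0).
    { rewrite Rabs_mult; apply Rmult_le_compat; try apply Rabs_pos; [lra|].
      apply Hxm; lra. }
    apply Rabs_le_between in Hm; lra. }
assert (H1 := Hinc (z - rh) z ltac:(lra) ltac:(lra) ltac:(lra)).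
assert (H2 := Hinc z (z + rh) ltac:(lra) ltac:(lra) ltac:(lra)).
replace (z - (z - rh)) with rh in H1 by ring; replace (z + rh - z) with rh in H2 by ring.
apply Rabs_lt_between in Hxy.
(* The values at [z - rh] and [z + rh] lie on either side of [x], at distance at least
   [(1 - eps0 * k0) * rh], and hence enclose [y]. *)
destruct (IVT_gen (fun w => w + th * kappa w) (z - rh) (z + rh) y) as [w [Hw Hwy]].
{ intros w; apply continuity_pt_filterlim.
  apply (ex_derive_continuous (fun w => w + th * kappa w)).
  auto_derive; repeat split; apply (Hsm 0%nat). }
{ rewrite Rmin_left, Rmax_right; lra. }
rewrite Rmin_left, Rmax_right in Hw by lra.
exists w; split; [|apply Rabs_le; lra].
apply inD_iff; [apply Hpos|].
replace (y - w) with (th * kappa w) by lra.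
rewrite Rabs_mult, (Rabs_pos_eq (kappa w)) by (apply Rlt_le, Hpos).
apply Rmult_le_compat_r; [apply Rlt_le, Hpos | exact Hth].
Qed.

(** * Penalization, terminal time and growth *)

Lemma usc_penalized (T l u a c b : R) (V : R -> R -> R) :
  0 < l -> lsc_on T V ->
  usc_on T (fun s y => - (l * V s y + u * (a * (T - s) + c / 2 * y ^ 2 + b))).
Proof.
intros Hl HV t x Ht e He.
assert (He' : 0 < e / (3 * l)) by (apply Rdiv_lt_0_compat; lra).
destruct (HV t x Ht _ He') as [d1 [Hd1 H1]].
assert (He3 : 0 < e / 3) by lra.
assert (C2 : continuous (fun s => u * (a * (T - s))) t).
{ apply (ex_derive_continuous (fun s => u * (a * (T - s)))); auto_derive; trivial. }
assert (C3 : continuous (fun y => u * (c / 2 * y ^ 2 + b)) x).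
{ apply (ex_derive_continuous (fun y => u * (c / 2 * y ^ 2 + b))); auto_derive; trivial. }
destruct (proj1 (filterlim_locally _ _) C2 (mkposreal _ He3)) as [d2 H2].
destruct (proj1 (filterlim_locally _ _) C3 (mkposreal _ He3)) as [d3 H3].
exists (Rmin d1 (Rmin d2 d3)); split.
{ repeat apply Rmin_pos; [exact Hd1 | apply cond_pos | apply cond_pos]. }
intros s y Hs Hst Hyx.
assert (K1 := H1 s y Hs (Rlt_le_trans _ _ _ Hst (Rmin_l _ _)) (Rlt_le_trans _ _ _ Hyx (Rmin_l _ _))).
assert (K2 := H2 s (Rlt_le_trans _ _ _ (Rlt_le_trans _ _ _ Hst (Rmin_r _ _)) (Rmin_l _ _))).
assert (K3 := H3 y (Rlt_le_trans _ _ _ (Rlt_le_trans _ _ _ Hyx (Rmin_r _ _)) (Rmin_r _ _))).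
apply Rabs_lt_between in K2; apply Rabs_lt_between in K3.
unfold minus, plus, opp in K2, K3; simpl in K2, K3.
apply (Rmult_lt_compat_l l) in K1; [|exact Hl].
replace (l * (V t x - e / (3 * l))) with (l * V t x - e / 3) in K1 by (field; lra).
simpl; lra.
Qed.

(** Otherwise violating points would have both times tending to [T] and, along a subsequence, a
    common space limit [lx]; semicontinuity would give [A T lx + B T lx > 0], as each of the two
    functions loses less than half of [theta]. *)
Lemma usc_sum_small_near_terminal (T r theta : R) (A B : R -> R -> R) :
  0 <= T -> usc_on T A -> usc_on T B -> (forall x, A T x + B T x <= 0) -> 0 < theta ->
  exists d, 0 < d /\ forall t x s y, T - d < t <= T -> 0 <= t -> - r <= x <= r ->
    T - d < s <= T -> 0 <= s -> - r <= y <= r -> Rabs (x - y) < d ->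
    A t x + B s y < theta.
Proof.
intros HT HA HB HAB Hth; apply NNPP; intros Hn.
assert (H : forall k : nat, exists p : (R * R) * (R * R),
  let '((t, x), (s, y)) := p in
  (T - / INR (S k) < t <= T /\ 0 <= t /\ - r <= x <= r) /\
  (T - / INR (S k) < s <= T /\ 0 <= s /\ - r <= y <= r) /\
  Rabs (x - y) < / INR (S k) /\ theta <= A t x + B s y).
{ intros k; apply NNPP; intros Hk; apply Hn; exists (/ INR (S k)); split.
  { apply Rinv_0_lt_compat, lt_0_INR; lia. }
  intros t x s y H1 H2 H3 H4 H5 H6 H7; apply Rnot_le_lt; intros H8; apply Hk.
  exists ((t, x), (s, y)); tauto. }
destruct (constructive_indefinite_description _ (choice _ H)) as [p Hp].
set (t := fun k => fst (fst (p k))); set (x := fun k => snd (fst (p k))).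
set (s := fun k => fst (snd (p k))); set (y := fun k => snd (snd (p k))).
assert (Hq : forall k,
  (T - / INR (S k) < t k <= T /\ 0 <= t k /\ - r <= x k <= r) /\
  (T - / INR (S k) < s k <= T /\ 0 <= s k /\ - r <= y k <= r) /\
  Rabs (x k - y k) < / INR (S k) /\ theta <= A (t k) (x k) + B (s k) (y k)).
{ intros k; generalize (Hp k); unfold t, x, s, y.
  destruct (p k) as [[t' x'] [s' y']]; simpl; tauto. }
assert (L0 : is_lim_seq (fun k => / INR (S k)) 0).
{ apply (is_lim_seq_incr_1 (fun k => / INR k)).
  apply (is_lim_seq_inv INR p_infty); [apply is_lim_seq_INR | discriminate]. }
assert (L1 : is_lim_seq (fun k => T - / INR (S k)) T).
{ replace (Finite T) with (Finite (T - 0)) by (f_equal; ring).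
  apply is_lim_seq_minus'; [apply is_lim_seq_const | exact L0]. }
assert (Lt : is_lim_seq t T).
{ apply (is_lim_seq_le_le _ _ _ _ (fun k => conj (Rlt_le _ _ (proj1 (proj1 (proj1 (Hq k)))))
    (proj2 (proj1 (proj1 (Hq k))))) L1 (is_lim_seq_const T)). }
assert (Ls : is_lim_seq s T).
{ apply (is_lim_seq_le_le _ _ _ _ (fun k => conj (Rlt_le _ _ (proj1 (proj1 (proj1 (proj2 (Hq k))))))
    (proj2 (proj1 (proj1 (proj2 (Hq k)))))) L1 (is_lim_seq_const T)). }
destruct (bounded_seq_cluster x (- r) r) as [phi [lx [Hphi [_ Lx]]]]; [intros k; apply (Hq k)|].
assert (Ly : is_lim_seq (fun k => y (phi k)) lx).
{ assert (L2 := is_lim_seq_subseq _ _ _ Hphi L0).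
  replace (Finite lx) with (Finite (lx - 0)) by (f_equal; ring).
  apply (is_lim_seq_ext (fun k => x (phi k) - (x (phi k) - y (phi k)))).
  { intros k; ring. }
  apply is_lim_seq_minus'; [exact Lx|].
  apply is_lim_seq_abs_0; apply (is_lim_seq_le_le (fun _ => 0) _ (fun k => / INR (S (phi k)))).
  - intros k; split; [apply Rabs_pos | apply Rlt_le, (Hq (phi k))].
  - apply is_lim_seq_const.
  - exact L2. }
assert (Hth2 : 0 < theta / 2) by lra.
assert (HTT : 0 <= T <= T) by lra.
assert (EA := usc_seq T A (fun k => t (phi k)) (fun k => x (phi k)) T lx (theta / 2) HA
  (fun k => conj (proj1 (proj2 (proj1 (Hq (phi k))))) (proj2 (proj1 (proj1 (Hq (phi k)))))) HTT
  (is_lim_seq_subseq _ _ _ Hphi Lt) Lx Hth2).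
assert (EB := usc_seq T B (fun k => s (phi k)) (fun k => y (phi k)) T lx (theta / 2) HB
  (fun k => conj (proj1 (proj2 (proj1 (proj2 (Hq (phi k)))))) (proj2 (proj1 (proj1 (proj2 (Hq (phi k))))))) HTT
  (is_lim_seq_subseq _ _ _ Hphi Ls) Ly Hth2).
destruct (filter_and _ _ EA EB) as [N HN].
destruct (HN N (Nat.le_refl _)) as [K1 K2].
destruct (Hq (phi N)) as [_ [_ [_ K3]]].
generalize (HAB lx); lra.
Qed.

(** Completing the square in [x - y] leaves a quadratic inequality for [Rabs y], with constant [G2];
    completing it in [y] leaves one for [Rabs (x - y)], with constant [G1]. *)
Lemma doubled_penalty_coercive (C k : R) : 0 <= C -> 0 < k ->
  exists r, 0 < r /\ forall x y,
    0 < C * (1 + Rabs x) + C * (1 + Rabs y) - k * y ^ 2 - (x - y) ^ 2 ->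
    Rabs x < r /\ Rabs y < r.
Proof.
intros HC Hk.
set (G1 := 2 * C + C * C / k); set (G2 := 2 * C + C * C / 4).
assert (HCC : 0 <= C * C) by (apply Rmult_le_pos; lra).
assert (HG1 : 0 <= G1).
{ assert (0 <= C * C / k) by (apply Rdiv_le_0_compat; lra); unfold G1; lra. }
assert (HG2 : 0 <= G2) by (unfold G2; lra).
set (r2 := (G2 + 2 * C) / k + 1).
assert (Hr2 : 1 <= r2).
{ assert (0 <= (G2 + 2 * C) / k) by (apply Rdiv_le_0_compat; lra); unfold r2; lra. }
exists (r2 + (G1 + C + 1)); split; [lra|].
intros x y H.
assert (Hx : Rabs x <= Rabs (x - y) + Rabs y).
{ replace x with ((x - y) + y) at 1 by ring; apply Rabs_triang. }
assert (HC' : C * Rabs x <= C * (Rabs (x - y) + Rabs y)) by (apply Rmult_le_compat_l; assumption).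
rewrite <- (pow2_abs y), <- (pow2_abs (x - y)) in H.
assert (HD := Rabs_pos (x - y)); assert (HY := Rabs_pos y).
set (D := Rabs (x - y)) in *; set (Y := Rabs y) in *; clearbody D Y.
assert (Y1 : Y < r2).
{ apply Rnot_le_lt; intros HYr.
  assert (K1 : G2 + 2 * C + k <= k * Y).
  { apply (Rmult_le_compat_l k) in HYr; [|lra].
    replace (k * r2) with (G2 + 2 * C + k) in HYr by (unfold r2; field; lra); exact HYr. }
  assert (K2 : 1 * (G2 + k) <= Y * (k * Y - 2 * C)) by (apply Rmult_le_compat; lra).
  assert (0 <= (D - C / 2) ^ 2) by apply pow2_ge_0.
  unfold G2 in K2; lra. }
assert (D1 : D < G1 + C + 1).
{ apply Rnot_le_lt; intros HDr.
  assert (K2 : 1 * (G1 + 1) <= D * (D - C)) by (apply Rmult_le_compat; lra).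
  assert (K3 : 0 <= k * (Y - C / k) ^ 2) by (apply Rmult_le_pos; [lra | apply pow2_ge_0]).
  replace (k * (Y - C / k) ^ 2) with (k * Y ^ 2 - 2 * C * Y + C * C / k) in K3 by (field; lra).
  unfold G1 in K2; lra. }
lra.
Qed.

(** * The comparison argument *)

Lemma comparison_penalized
  (T : R) (f sigma gbar : R -> R) (iota xK cf Cs C u b : R) (ghat : R -> R)
  (eps0 : R) (kappa : R -> R) (eps : R) (U V : R -> R -> R) :
  0 < T -> 0 < cf -> (forall x, cf <= f x) -> (forall x, continuous f x) ->
  (forall x, sigma x ^ 2 <= Cs) -> (forall x, continuous sigma x) ->
  (forall x, continuous gbar x) -> 0 < iota -> (forall x, iota <= gbar x <= / f x - iota) ->
  0 < xK -> affine_right_of ghat xK -> affine_left_of ghat xK ->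
  0 < eps0 -> Cinf_bdd_derivs kappa -> (forall x, 0 < kappa x) ->
  (forall x, (x <= - xK \/ xK <= x) -> kappa x = Rabs (ghat x) + 1) ->
  (forall x, - / eps0 < Derive kappa x < / eps0) -> 0 <= eps <= eps0 ->
  visc_subsol T eps kappa sigma f gbar U ->
  visc_supersol T eps kappa sigma f gbar V ->
  (forall x, U T x <= V T x) -> 0 <= C -> 0 < Cs ->
  (forall t x, 0 <= t <= T -> Rabs (U t x) <= C * (1 + Rabs x)) ->
  (forall t x, 0 <= t <= T -> Rabs (V t x) <= C * (1 + Rabs x)) ->
  0 < u < 1 -> 0 <= b -> (forall x, V T x <= iota / 2 / 2 * x ^ 2 + b) ->
  forall t x, 0 <= t <= T ->
    U t x <= (1 - u) * V t x + u * ((Cs * iota + 1) * (T - t) + iota / 2 / 2 * x ^ 2 + b).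
Proof.
intros HT Hcf Hf Hfc HCs Hsc Hgc Hi Hg HxK Hgr Hgl Heps0 Hks Hkp Hko HkD Heps HU HV HUV HC HCsp
  HUg HVg Hu Hb HVT t x Ht.
apply Rnot_lt_le; intros Hlt.
set (a := Cs * iota + 1) in *; set (c := iota / 2) in *.
assert (Ha : 0 < a).
{ assert (0 < Cs * iota) by (apply Rmult_lt_0_compat; assumption); unfold a; lra. }
set (B := fun s y => - ((1 - u) * V s y + u * (a * (T - s) + c / 2 * y ^ 2 + b))).
assert (HuB : usc_on T B) by (apply usc_penalized; [lra | apply HV]).
set (theta := U t x + B t x).
assert (Hth : 0 < theta) by (unfold theta, B; lra).
assert (Hk : 0 < u * (c / 2)) by (unfold c; apply Rmult_lt_0_compat; lra).
(* The box size [r] does not depend on the doubling parameter [n], of which only [n >= 1] will be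
   used here. *)
destruct (doubled_penalty_coercive C (u * (c / 2)) HC Hk) as [r [Hr Hcoer]].
assert (Hgrow : forall t x s y, 0 <= t <= T -> 0 <= s <= T ->
  U t x + B s y <= C * (1 + Rabs x) + C * (1 + Rabs y) - u * (c / 2) * y ^ 2).
{ clear t x Ht Hlt theta Hth; intros t x s y Ht Hs.
  assert (H1 := HUg t x Ht); assert (H2 := HVg s y Hs).
  apply Rabs_le_between in H1; apply Rabs_le_between in H2.
  assert (0 <= u * (a * (T - s) + b)).
  { apply Rmult_le_pos; [lra|]; apply Rplus_le_le_0_compat; [|exact Hb].
    apply Rmult_le_pos; lra. }
  assert ((1 - u) * - V s y <= (1 - u) * (C * (1 + Rabs y))) by (apply Rmult_le_compat_l; lra).
  assert (0 <= u * (C * (1 + Rabs y))).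
  { apply Rmult_le_pos; [lra|]; apply Rmult_le_pos; [exact HC|]; generalize (Rabs_pos y); lra. }
  unfold B; lra. }
assert (Hterm : forall x, U T x + B T x <= 0).
{ intros z.
  assert (u * V T z <= u * (c / 2 * z ^ 2 + b)) by (apply Rmult_le_compat_l; [lra | apply HVT]).
  generalize (HUV z); unfold B; lra. }
destruct (usc_sum_small_near_terminal T r theta U B) as [d1 [Hd1 Hd1']]; auto; try lra.
{ apply HU. }
destruct (no_crossing iota cf Cs u) as [e [He Hcross]]; auto.
destruct (inD_lower_semicontinuous eps0 eps xK r kappa ghat) as [b0 Hb0]; auto.
assert (Cont : forall g : R -> R, (forall z, continuous g z) ->
  exists rho, 0 < rho /\ forall z z', - (b0 + 1) <= z <= b0 + 1 -> - (b0 + 1) <= z' <= b0 + 1 ->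
    Rabs (z - z') < rho -> Rabs (g z - g z') <= e).
{ intros g Hgcont.
  destruct (@Heine_cor2 g (- (b0 + 1)) (b0 + 1)
    (fun z _ => proj2 (continuity_pt_filterlim g z) (Hgcont z)) (mkposreal e He)) as [[rho Hrho] H].
  exists rho; split; [exact Hrho|]; intros; apply Rlt_le, H; assumption. }
destruct (Cont (fun z => sigma z ^ 2)) as [rs [Hrs Ms]].
{ intros z; apply (continuous_mult sigma (fun w => sigma w * 1)); [apply Hsc|].
  apply (continuous_mult sigma (fun w => 1)); [apply Hsc | apply continuous_const]. }
destruct (Cont f Hfc) as [rf [Hrf Mf]].
destruct (Cont gbar Hgc) as [rg [Hrg Mg]].
(* [rho < 1] keeps the companion point [z'] in the interval of radius [b0 + 1] on which the moduli
   of continuity hold. *)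
set (rho := Rmin (Rmin rs rf) (Rmin rg 1) / 2).
assert (Hrho : 0 < rho /\ rho < rs /\ rho < rf /\ rho < rg /\ rho < 1).
{ unfold rho, Rmin; repeat destruct (Rle_dec _ _); lra. }
clearbody rho; destruct Hrho as [Hrho [Hrhos [Hrhof [Hrhog Hrho1]]]].
destruct (Hb0 rho Hrho) as [d2 [Hd2 HD]].
(* The difference [x1 - y1] is split through [x0] and [y0] into three pieces, each smaller than
   [d]. *)
set (d := Rmin d1 (d2 / 3)).
assert (Hd : 0 < d) by (apply Rmin_pos; lra).
assert (Hdd1 : d <= d1) by apply Rmin_l.
assert (Hdd2 : d <= d2 / 3) by apply Rmin_r.
(* [bd] bounds [U + B] at the maximiser, where the functional is positive; [n * d^2 > bd] thus
   forces both doubled pairs to be closer than [d]. *)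
set (bd := C * (1 + r) + C * (1 + r)).
assert (Hbd : 0 <= bd).
{ assert (0 <= C * (1 + r)) by (apply Rmult_le_pos; lra); unfold bd; lra. }
assert (Hdsq : 0 < d ^ 2) by (apply pow_lt; exact Hd).
set (n := 1 + bd / d ^ 2).
assert (Hn1 : 1 <= n).
{ assert (0 <= bd / d ^ 2) by (apply Rdiv_le_0_compat; lra); unfold n; lra. }
assert (Hnd : bd < n * d ^ 2).
{ unfold n; replace ((1 + bd / d ^ 2) * d ^ 2) with (d ^ 2 + bd) by (field; lra); lra. }
clearbody n.
destruct (usc_sum_max T r r U B (fun t x s y => - n * (t - s) ^ 2 - n * (x - y) ^ 2))
  as [t0 [x0 [s0 [y0 [[Bt [Bx [Bs By]]] Hmax]]]]]; auto; try lra.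
{ apply HU. }
{ intros; lim_poly. }
assert (Hin : forall t x s y, 0 <= t <= T -> 0 <= s <= T ->
  0 < U t x + B s y - n * (t - s) ^ 2 - n * (x - y) ^ 2 -> Rabs x < r /\ Rabs y < r).
{ clear t x Ht Hlt theta Hth Hd1'; intros t x s y Ht Hs Hp; apply Hcoer.
  assert (0 <= n * (t - s) ^ 2) by (apply Rmult_le_pos; [lra | apply pow2_ge_0]).
  assert (1 * (x - y) ^ 2 <= n * (x - y) ^ 2) by (apply Rmult_le_compat_r; [apply pow2_ge_0 | lra]).
  generalize (Hgrow t x s y Ht Hs); lra. }
assert (Hx : Rabs x < r).
{ apply (Hin t x t x Ht Ht); replace (t - t) with 0 by ring; replace (x - x) with 0 by ring.
  unfold theta in Hth; lra. }
assert (Hval : theta <= U t0 x0 + B s0 y0 - n * (t0 - s0) ^ 2 - n * (x0 - y0) ^ 2).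
{ apply Rabs_lt_between in Hx.
  generalize (Hmax t x t x Ht ltac:(lra) Ht ltac:(lra)); unfold theta.
  replace (t - t) with 0 by ring; replace (x - x) with 0 by ring; lra. }
destruct (Hin t0 x0 s0 y0 Bt Bs) as [Hx0 Hy0]; [lra|].
assert (Hnt : 0 <= n * (t0 - s0) ^ 2) by (apply Rmult_le_pos; [lra | apply pow2_ge_0]).
assert (Hnx : 0 <= n * (x0 - y0) ^ 2) by (apply Rmult_le_pos; [lra | apply pow2_ge_0]).
assert (Hsum : U t0 x0 + B s0 y0 <= bd).
{ assert (C * Rabs x0 <= C * r) by (apply Rmult_le_compat_l; lra).
  assert (C * Rabs y0 <= C * r) by (apply Rmult_le_compat_l; lra).
  assert (0 <= u * (c / 2) * y0 ^ 2) by (apply Rmult_le_pos; [lra | apply pow2_ge_0]).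
  generalize (Hgrow t0 x0 s0 y0 Bt Bs); unfold bd; lra. }
assert (Hclose : forall v, n * v ^ 2 <= bd -> Rabs v < d).
{ intros v Hv; rewrite <- (Rabs_pos_eq d) by lra; apply Rsqr_lt_abs_0; rewrite !Rsqr_pow2.
  apply Rmult_lt_reg_l with n; lra. }
assert (Hts : Rabs (t0 - s0) < d) by (apply Hclose; lra).
assert (Hxy : Rabs (x0 - y0) < d) by (apply Hclose; lra).
assert (Hts' := Hts); apply Rabs_lt_between in Hts'.
apply Rabs_lt_between in Hx0; apply Rabs_lt_between in Hy0.
(* If one time were [T], both would be within [d1] of [T], where the sum is below [theta], whereas
   the maximum is at least [theta]. *)
assert (Hint : t0 < T /\ s0 < T).
{ assert (Hcase : t0 < T /\ s0 < T \/ (T - d1 < t0 /\ T - d1 < s0)) by lra.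
  destruct Hcase as [Hcase|[K1 K2]]; [exact Hcase|].
  generalize (Hd1' t0 x0 s0 y0 ltac:(lra) ltac:(lra) Bx ltac:(lra) ltac:(lra) By ltac:(lra)); lra. }
set (d3 := Rmin (Rmin (Rmin d e) (Rmin (r - x0) (x0 + r))) (Rmin (T - t0) (T - s0))).
assert (Hd3 : 0 < d3 /\ d3 <= d /\ d3 <= e /\ d3 <= r - x0 /\ d3 <= x0 + r /\
  d3 <= T - t0 /\ d3 <= T - s0).
{ unfold d3, Rmin; repeat destruct (Rle_dec _ _); lra. }
clearbody d3.
destruct (theorem_on_sums T r n t0 x0 s0 y0 d3 U B)
  as [t1 [x1 [q1 [M1 [s1 [y1 [q2 [M2 [[Pt1 [Dt1 [Dx1 J1]]] [[Ps1 [Ds1 [Dy1 J2]]] [Dq DM]]]]]]]]]]];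
  auto; try lra.
{ apply HU. }
{ intros t' x' s' y' H1 H2 H3 H4; generalize (Hmax t' x' s' y' H1 H2 H3 H4); lra. }
apply Rabs_lt_between in Dt1; apply Rabs_lt_between in Dx1.
apply Rabs_lt_between in Ds1; apply Rabs_lt_between in Dy1.
apply Rabs_lt_between in Hxy; apply Rabs_lt_between in Dq.
destruct (visc_subsol_quad_jet T eps kappa sigma f gbar U t1 x1 q1 M1 HU ltac:(lra) J1)
  as [z [Dz Fz]].
destruct (HD x1 y1 z) as [Hz [z' [Dz' Hzz']]]; auto.
{ apply Rabs_le; lra. }
{ apply Rabs_lt_between; lra. }
apply quad_jet_penalized in J2; [|lra].
assert (Fz' := visc_supersol_quad_jet T eps kappa sigma f gbar V s1 y1 _ _ HV ltac:(lra) J2 z' Dz').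
assert (Hz0 := Hz); assert (Hzz0 := Hzz').
apply Rabs_le_between in Hz0; apply Rabs_le_between in Hzz0.
apply (Hcross (sigma z ^ 2) (sigma z' ^ 2) (f z) (f z') (gbar z) (gbar z') q1
  (- ((q2 - u * a) / (1 - u))) M1 (- ((M2 + u * c) / (1 - u)))); auto.
- split; [apply pow2_ge_0 | apply HCs].
- split; [apply pow2_ge_0 | apply HCs].
- apply Ms; lra.
- apply Mf; lra.
- apply Mg; lra.
- fold a; replace ((1 - u) * - ((q2 - u * a) / (1 - u))) with (u * a - q2) by (field; lra); lra.
- fold c; replace ((1 - u) * - ((M2 + u * c) / (1 - u))) with (- M2 - u * c) by (field; lra); lra.
Qed.

Theorem theorem2p2
  (T : R) (f sigma gbar : R -> R) (iota K xK : R) (ghat : R -> R)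
  (eps0 : R) (kappa : R -> R) (eps : R) (U V : R -> R -> R)
  (* standing assumptions *)
  (HT : 0 < T)
  (Hf : C2b f) (Hfinf : exists c, 0 < c /\ forall x, c <= f x)
  (Hsig_b : bounded_fun sigma) (Hsig_L : lipschitz_fun sigma)
  (Hsig_inf : exists c, 0 < c /\ forall x, c <= sigma x)
  (Hg_b : bounded_fun gbar) (Hg_c : forall x, continuous gbar x)
  (Hiota : 0 < iota) (Hg_rng : forall x, iota <= gbar x <= / f x - iota)
  (HK : 0 < K) (HxK : K <= xK)
  (Hghat_uc : unif_continuous ghat)
  (Hghat_r : affine_right_of ghat xK) (Hghat_l : affine_left_of ghat xK)
  (Heps0 : 0 < eps0 < 1)
  (Hkap_smooth : Cinf_bdd_derivs kappa)
  (Hkap_inf : exists c, 0 < c /\ forall x, c <= kappa x)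
  (Hkap_out : forall x, (x <= - xK \/ xK <= x) -> kappa x = Rabs (ghat x) + 1)
  (Hkap_der : forall x, - / eps0 < Derive kappa x < / eps0)
  (* theorem hypotheses *)
  (Heps : 0 <= eps <= eps0)
  (HU : visc_subsol T eps kappa sigma f gbar U)
  (HV : visc_supersol T eps kappa sigma f gbar V)
  (HUg : linear_growth T U) (HVg : linear_growth T V)
  (HUV_T : forall x, U T x <= V T x) :
  forall t x, 0 <= t <= T -> U t x <= V t x.
Proof.
destruct Hfinf as [cf [Hcf Hcf']].
destruct Hkap_inf as [ck [Hck Hck']].
destruct Hsig_b as [Cb HCb].
destruct Hsig_L as [L HL].
destruct HUg as [C1 HC1]; destruct HVg as [C2 HC2].
set (C := Rabs C1 + Rabs C2).
assert (HC : 0 <= C) by (unfold C; generalize (Rabs_pos C1) (Rabs_pos C2); lra).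
assert (HUC : forall t x, 0 <= t <= T -> Rabs (U t x) <= C * (1 + Rabs x)).
{ intros t x Ht; apply Rle_trans with (1 := HC1 t x Ht), Rmult_le_compat_r.
  - generalize (Rabs_pos x); lra.
  - unfold C; generalize (Rle_abs C1) (Rabs_pos C2); lra. }
assert (HVC : forall t x, 0 <= t <= T -> Rabs (V t x) <= C * (1 + Rabs x)).
{ intros t x Ht; apply Rle_trans with (1 := HC2 t x Ht), Rmult_le_compat_r.
  - generalize (Rabs_pos x); lra.
  - unfold C; generalize (Rle_abs C2) (Rabs_pos C1); lra. }
assert (HCs : forall x, sigma x ^ 2 <= Cb ^ 2 + 1).
{ intros x; assert (sigma x ^ 2 <= Cb ^ 2); [|lra].
  apply pow_maj_Rabs, HCb. }
assert (HCsp : 0 < Cb ^ 2 + 1) by (generalize (pow2_ge_0 Cb); lra).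
assert (Hfc : forall x, continuous f x) by (intros x; apply (ex_derive_continuous f), Hf).
assert (Hsc : forall x, continuous sigma x).
{ intros x; apply filterlim_locally; intros e.
  assert (HLp : 0 < Rabs L + 1) by (generalize (Rabs_pos L); lra).
  exists (mkposreal _ (Rdiv_lt_0_compat _ _ (cond_pos e) HLp)); intros y Hy.
  apply Rle_lt_trans with (1 := HL y x).
  apply Rle_lt_trans with ((Rabs L + 1) * Rabs (y - x)).
  - apply Rmult_le_compat_r; [apply Rabs_pos | generalize (Rle_abs L); lra].
  - apply (Rmult_lt_compat_l _ _ _ HLp) in Hy; simpl in Hy.
    replace ((Rabs L + 1) * (e / (Rabs L + 1))) with (pos e) in Hy by (field; lra); exact Hy. }
(* From [C |x| <= iota / 4 * x^2 + C^2 / iota]. *)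
set (b := C + C * C / iota).
assert (Hb : 0 <= b).
{ assert (0 <= C * C / iota) by (apply Rdiv_le_0_compat; [apply Rmult_le_pos|]; lra).
  unfold b; lra. }
assert (HVT : forall x, V T x <= iota / 2 / 2 * x ^ 2 + b).
{ intros x; generalize (HVC T x ltac:(lra)); intros H; apply Rabs_le_between in H.
  assert (H0 : 0 <= iota * (Rabs x / 2 - C / iota) ^ 2).
  { apply Rmult_le_pos; [lra | apply pow2_ge_0]. }
  replace (iota * (Rabs x / 2 - C / iota) ^ 2)
    with (iota / 4 * Rabs x ^ 2 - C * Rabs x + C * C / iota) in H0 by (field; lra).
  rewrite pow2_abs in H0; unfold b; lra. }
intros t x Ht.
apply Rnot_lt_le; intros Hlt.
set (D := (Cb ^ 2 + 1) * iota + 1) in *.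
set (phi := D * (T - t) + iota / 2 / 2 * x ^ 2 + b).
set (w := Rabs (phi - V t x) + 1).
assert (Hw : 0 < w) by (unfold w; generalize (Rabs_pos (phi - V t x)); lra).
(* At the fixed point [(t, x)] the penalty costs at most [u * w]; this weight makes it at most half
   of the supposed gap [U t x - V t x]. *)
set (u := Rmin (/ 2) ((U t x - V t x) / (2 * w))).
assert (Hu0 : 0 < u) by (apply Rmin_pos; [lra | apply Rdiv_lt_0_compat; lra]).
assert (Hu1 : u <= / 2) by apply Rmin_l.
assert (Hu2 : u * w <= (U t x - V t x) / 2).
{ apply Rle_trans with ((U t x - V t x) / (2 * w) * w).
  - apply Rmult_le_compat_r; [lra | apply Rmin_r].
  - apply Req_le; field; lra. }
assert (H := comparison_penalized T f sigma gbar iota xK cf (Cb ^ 2 + 1) C u b ghat eps0 kappa eps U V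
  HT Hcf Hcf' Hfc HCs Hsc Hg_c Hiota Hg_rng ltac:(lra) Hghat_r Hghat_l ltac:(lra) Hkap_smooth
  ltac:(intros z; generalize (Hck' z); lra) Hkap_out Hkap_der Heps HU HV HUV_T HC HCsp HUC HVC
  ltac:(lra) Hb HVT t x Ht).
fold D in H; fold phi in H.
assert (u * (phi - V t x) <= u * w).
{ apply Rmult_le_compat_l; [lra|]; unfold w; generalize (Rle_abs (phi - V t x)); lra. }
lra.
Qed.
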